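(* There exists a universal constant $C\in(0,\infty)$ such that for every two Banach spaces $X,Y$ with $\dim X=n<\infty$ and $\dim Y=\infty$, and every $\varepsilon\in(0,1)$, $$\delta_{X\hookrightarrow Y}(\varepsilon)\ge e^{-(n/\varepsilon)^{Cn}}.$$
   Context: For metric spaces $(M,d_M),(N,d_N)$, the distortion $c_N(M)$ is the infimum over $D\in[1,\infty]$ for which there exist $g:M\to N$ and $s>0$ with $s\,d_M(x,y)\le d_N(g(x),g(y))\le Ds\,d_M(x,y)$ for all $x,y\in M$. For a Banach space $X$ with unit ball $B_X$ and $\delta\in(0,1)$, a $\delta$-net in $B_X$ is a subset $\mathcal N\subseteq B_X$ such that every $x\in B_X$ satisfies $\|x-p\|_X\le\delta$ for some $p\in\mathcal N$. The discretization modulus $\delta_{X\hookrightarrow Y}(\varepsilon)$, for $\varepsilon\in(0,1)$, is the supremum of those $\delta\in(0,1)$ such that every $\delta$-net $\mathcal N_\delta$ in $B_X$ satisfies $c_Y(\mathcal N_\delta)\ge(1-\varepsilon)c_Y(X)$. *)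

(* Defs.v *)
From Stdlib Require Import Reals Lra ClassicalEpsilon.
Open Scope R_scope.

Record NormedSpace := {
  V :> Type;
  vzero : V;
  vadd : V -> V -> V;
  vopp : V -> V;
  vscal : R -> V -> V;
  vnorm : V -> R;
  vadd_assoc : forall x y z, vadd x (vadd y z) = vadd (vadd x y) z;
  vadd_comm : forall x y, vadd x y = vadd y x;
  vadd_0 : forall x, vadd x vzero = x;
  vadd_opp : forall x, vadd x (vopp x) = vzero;
  vscal_1 : forall x, vscal 1 x = x;
  vscal_assoc : forall a b x, vscal a (vscal b x) = vscal (a * b) x;
  vscal_distr_v : forall a x y, vscal a (vadd x y) = vadd (vscal a x) (vscal a y);
  vscal_distr_s : forall a b x, vscal (a + b) x = vadd (vscal a x) (vscal b x);
  vnorm_eq0 : forall x, vnorm x = 0 -> x = vzero;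
  vnorm_scal : forall a x, vnorm (vscal a x) = Rabs a * vnorm x;
  vnorm_triangle : forall x y, vnorm (vadd x y) <= vnorm x + vnorm y
}.

Arguments vzero {_}. Arguments vadd {_}. Arguments vopp {_}.
Arguments vscal {_}. Arguments vnorm {_}.

Definition vdist {X : NormedSpace} (x y : X) : R := vnorm (vadd x (vopp y)).

Definition Banach (X : NormedSpace) : Prop :=
  forall u : nat -> X,
    (forall eps, 0 < eps -> exists N, forall m k, (N <= m)%nat -> (N <= k)%nat ->
        vdist (u m) (u k) < eps) ->
    exists l : X, forall eps, 0 < eps -> exists N, forall k, (N <= k)%nat ->
        vdist (u k) l < eps.

Fixpoint lincomb {X : NormedSpace} (c : nat -> R) (e : nat -> X) (n : nat) : X :=
  match n with
  | O => vzero
  | S k => vadd (lincomb c e k) (vscal (c k) (e k))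
  end.

Definition lin_indep {X : NormedSpace} (e : nat -> X) (n : nat) : Prop :=
  forall c, lincomb c e n = vzero -> forall i, (i < n)%nat -> c i = 0.

Definition spans {X : NormedSpace} (e : nat -> X) (n : nat) : Prop :=
  forall x : X, exists c, x = lincomb c e n.

Definition has_dim (X : NormedSpace) (n : nat) : Prop :=
  exists e : nat -> X, lin_indep e n /\ spans e n.

Definition infinite_dim (X : NormedSpace) : Prop :=
  forall m : nat, exists e : nat -> X, lin_indep e m.

Inductive ER := Fin (r : R) | PInf.

Definition ER_le (a b : ER) : Prop :=
  match a, b with
  | Fin x, Fin y => x <= y
  | _, PInf => True
  | PInf, Fin _ => False
  end.

Definition ER_scale (t : R) (a : ER) : ER :=
  match a with Fin x => Fin (t * x) | PInf => PInf end.

Definition embeds_with (X Y : NormedSpace) (M : X -> Prop) (D : R) : Prop :=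
  exists (g : X -> Y) (s : R), 0 < s /\
    forall x y, M x -> M y ->
      s * vdist x y <= vdist (g x) (g y) /\ vdist (g x) (g y) <= D * s * vdist x y.

Definition is_distortion (X Y : NormedSpace) (M : X -> Prop) (c : ER) : Prop :=
  match c with
  | Fin r =>
      (forall D, 1 <= D -> embeds_with X Y M D -> r <= D) /\
      (forall r', (forall D, 1 <= D -> embeds_with X Y M D -> r' <= D) -> r' <= r) /\
      (exists D, 1 <= D /\ embeds_with X Y M D)
  | PInf => forall D, 1 <= D -> ~ embeds_with X Y M D
  end.

Definition distortion (X Y : NormedSpace) (M : X -> Prop) : ER :=
  epsilon (inhabits PInf) (is_distortion X Y M).

Definition delta_net (X : NormedSpace) (delta : R) (N : X -> Prop) : Prop :=
  (forall p, N p -> vnorm p <= 1) /\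
  (forall x : X, vnorm x <= 1 -> exists p, N p /\ vdist x p <= delta).

Definition disc_good (X Y : NormedSpace) (eps delta : R) : Prop :=
  forall N : X -> Prop, delta_net X delta N ->
    ER_le (ER_scale (1 - eps) (distortion X Y (fun _ => True))) (distortion X Y N).

Definition is_disc_modulus (X Y : NormedSpace) (eps m : R) : Prop :=
  is_lub (fun delta => 0 < delta < 1 /\ disc_good X Y eps delta) m.

(* Main.v *)
(** Rescale a delta-net embedding to a map [F] on a huge ball of [X], bi-Lipschitz with
    constants 1 and [D] up to a small additive error.  Let [A] be the lattice points with
    coordinates in [-P, P] with respect to a basis of unit vectors whose coordinate
    functionals have norm at most 2.  Average [F] successively along progressions
    x, x + a, ..., x + (m-1) a, letting [a] run cyclically through [A] while [m] grows
    geometrically.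

    Averaging never increases the supremum over x of
    Psi(x) = sum over b in [A] of |f (x + b) - f x|, and by the triangle inequality along
    the progression the step in direction [a] gains |a| - 1 on the sum with the term [a]
    left out.  If after a full pass over [A] the supremum has dropped by less than 1, then
    at some point x every increment in a direction a of [A] has norm at least |a| - 2.  As
    Psi is nonnegative and initially of order [D] times the size of [A], this happens
    within that many passes.  The averaged map has tiny second differences, so its
    increments at that x along the basis define a linear map, which is an almost optimal
    embedding.

    That [D] may be assumed to be O(n^2), and that [A] has only (n / eps)^O(n) elements,
    both follow from the existence of such bases, obtained by nearly maximizing a
    determinant. *)

Require Import Defs.
From Stdlib Require Import Reals Lra Lia List Classical ClassicalEpsilon.
From mathcomp Require all_boot all_order all_fingroup all_algebra Rstruct.
Open Scope R_scope.

Declare Scope vec_scope.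
Infix "[+]" := vadd (at level 50, left associativity) : vec_scope.
Notation "x [-] y" := (vadd x (vopp y)) (at level 50, left associativity) : vec_scope.
Infix "[*]" := vscal (at level 40, left associativity) : vec_scope.
Open Scope vec_scope.

(** * Vector identities by reflection *)

Lemma vscal_0_l {X : NormedSpace} (x : X) : 0 [*] x = vzero.
Proof.
  assert (H : 0 [*] x [+] 0 [*] x = 0 [*] x)
    by (rewrite <- vscal_distr_s; f_equal; ring).
  transitivity (0 [*] x [+] 0 [*] x [-] 0 [*] x).
  - rewrite <- vadd_assoc, vadd_opp. symmetry. apply vadd_0.
  - rewrite H. apply vadd_opp.
Qed.

Lemma vopp_scal {X : NormedSpace} (x : X) : vopp x = (-1) [*] x.
Proof.
  assert (H : x [+] (-1) [*] x = vzero).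
  { rewrite <- (vscal_1 _ x) at 1. rewrite <- vscal_distr_s.
    replace (1 + -1) with 0 by ring. apply vscal_0_l. }
  rewrite <- (vadd_0 _ (vopp x)), <- H, vadd_assoc, (vadd_comm _ (vopp x)), vadd_opp,
    vadd_comm, vadd_0. reflexivity.
Qed.

Lemma vscal_0_r {X : NormedSpace} (a : R) : a [*] (@vzero X) = vzero.
Proof.
  rewrite <- (vscal_0_l (@vzero X)), vscal_assoc. f_equal; ring.
Qed.

Lemma vadd_swap {X : NormedSpace} (a b c d : X) :
  (a [+] b) [+] (c [+] d) = (a [+] c) [+] (b [+] d).
Proof.
  rewrite <- !vadd_assoc. f_equal. rewrite !vadd_assoc. f_equal. apply vadd_comm.
Qed.

Lemma lincomb_ext {X : NormedSpace} (c c' : nat -> R) (e e' : nat -> X) n :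
  (forall i, (i < n)%nat -> c i = c' i) -> (forall i, (i < n)%nat -> e i = e' i) ->
  lincomb c e n = lincomb c' e' n.
Proof.
  induction n as [|n IH]; intros Hc He; simpl; [reflexivity|].
  rewrite IH, Hc, He; auto.
Qed.

Lemma lincomb_add {X : NormedSpace} (c c' : nat -> R) (e : nat -> X) n :
  lincomb (fun i => c i + c' i) e n = lincomb c e n [+] lincomb c' e n.
Proof.
  induction n as [|n IH]; simpl; [symmetry; apply vadd_0|].
  rewrite IH, vscal_distr_s. apply vadd_swap.
Qed.

Lemma lincomb_scal {X : NormedSpace} a (c : nat -> R) (e : nat -> X) n :
  lincomb (fun i => a * c i) e n = a [*] lincomb c e n.
Proof.
  induction n as [|n IH]; simpl; [symmetry; apply vscal_0_r|].
  rewrite IH, vscal_distr_v, vscal_assoc. reflexivity.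
Qed.

Lemma lincomb_0 {X : NormedSpace} (e : nat -> X) n : lincomb (fun _ => 0) e n = vzero.
Proof.
  induction n as [|n IH]; simpl; [reflexivity|]. rewrite IH, vscal_0_l. apply vadd_0.
Qed.

Lemma lincomb_unit {X : NormedSpace} (e : nat -> X) n j :
  (j < n)%nat -> lincomb (fun i => if Nat.eqb j i then 1 else 0) e n = e j.
Proof.
  induction n as [|n IH]; simpl; [lia|]. intros Hj.
  destruct (Nat.eqb_spec j n) as [->|Hn].
  - rewrite (lincomb_ext _ (fun _ => 0) e e).
    + rewrite lincomb_0, vscal_1, vadd_comm. apply vadd_0.
    + intros i Hi. destruct (Nat.eqb_spec n i); [lia|reflexivity].
    + reflexivity.
  - rewrite IH by lia. rewrite vscal_0_l. apply vadd_0.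
Qed.

(** Syntax for proof by reflection: both sides of a vector identity are formal combinations of
    finitely many atoms, so the identity reduces to one real equation per atom. *)
Inductive vexpr :=
| VAtom (i : nat) | VZero | VAdd (a b : vexpr) | VOpp (a : vexpr) | VScal (r : R) (a : vexpr).

Fixpoint veval {X : NormedSpace} (rho : nat -> X) (t : vexpr) : X :=
  match t with
  | VAtom i => rho i
  | VZero => vzero
  | VAdd a b => veval rho a [+] veval rho b
  | VOpp a => vopp (veval rho a)
  | VScal r a => r [*] veval rho a
  end.

Fixpoint vcoef (t : vexpr) (j : nat) : R :=
  match t with
  | VAtom i => if Nat.eqb i j then 1 else 0
  | VZero => 0
  | VAdd a b => vcoef a j + vcoef b j
  | VOpp a => - vcoef a j
  | VScal r a => r * vcoef a j
  end.

Fixpoint vatoms_lt (k : nat) (t : vexpr) : bool :=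
  match t with
  | VAtom i => Nat.ltb i k
  | VZero => true
  | VAdd a b => andb (vatoms_lt k a) (vatoms_lt k b)
  | VOpp a => vatoms_lt k a
  | VScal _ a => vatoms_lt k a
  end.

(** Recursion into a conjunction, so that [cbn] unfolds it to separate real equations for [ring] or
    [field]. *)
Fixpoint vcoefs_eq (k : nat) (s t : vexpr) : Prop :=
  match k with
  | O => True
  | S k => vcoefs_eq k s t /\ vcoef s k = vcoef t k
  end.

Lemma veval_lincomb {X : NormedSpace} (rho : nat -> X) k t :
  vatoms_lt k t = true -> veval rho t = lincomb (vcoef t) rho k.
Proof.
  induction t as [i| |a IHa b IHb|a IHa|r a IHa]; simpl; intros H.
  - apply Nat.ltb_lt in H. symmetry. apply (lincomb_unit rho k i H).
  - symmetry. apply lincomb_0.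
  - apply andb_prop in H. destruct H as [H1 H2].
    rewrite IHa, IHb by assumption. symmetry. apply lincomb_add.
  - rewrite IHa by assumption. rewrite vopp_scal, <- lincomb_scal.
    apply lincomb_ext; intros; [ring|reflexivity].
  - rewrite IHa by assumption. symmetry. apply lincomb_scal.
Qed.

Lemma veval_eq {X : NormedSpace} (rho : nat -> X) k s t :
  andb (vatoms_lt k s) (vatoms_lt k t) = true -> vcoefs_eq k s t ->
  veval rho s = veval rho t.
Proof.
  intros H Hc. apply andb_prop in H. destruct H as [H1 H2].
  rewrite (veval_lincomb rho k s H1), (veval_lincomb rho k t H2).
  apply lincomb_ext; [|reflexivity].
  clear H1 H2. induction k as [|k IH]; [lia|]. destruct Hc as [Hc He].
  intros i Hi. destruct (Nat.eq_dec i k) as [->|]; [exact He|apply IH; [exact Hc|lia]].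
Qed.

Ltac vec_index a l :=
  lazymatch l with
  | cons a _ => constr:(O)
  | cons _ ?l' => let i := vec_index a l' in constr:(S i)
  end.
Ltac vec_mem a l :=
  lazymatch l with
  | nil => constr:(false)
  | cons a _ => constr:(true)
  | cons _ ?l' => vec_mem a l'
  end.
Ltac vec_collect t l :=
  lazymatch t with
  | vzero => l
  | vadd ?a ?b => let l := vec_collect a l in vec_collect b l
  | vopp ?a => vec_collect a l
  | vscal _ ?a => vec_collect a l
  | ?a => lazymatch vec_mem a l with true => l | false => constr:(cons a l) end
  end.
Ltac vec_reify t l :=
  lazymatch t with
  | vzero => constr:(VZero)
  | vadd ?a ?b =>
      let a' := vec_reify a l in let b' := vec_reify b l in constr:(VAdd a' b')
  | vopp ?a => let a' := vec_reify a l in constr:(VOpp a')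
  | vscal ?r ?a => let a' := vec_reify a l in constr:(VScal r a')
  | ?a => let i := vec_index a l in constr:(VAtom i)
  end.
Ltac vec_coefs :=
  lazymatch goal with
  | |- @eq (V ?X) ?x ?y =>
      let l := vec_collect x (@nil X) in
      let l := vec_collect y l in
      let s := vec_reify x l in
      let t := vec_reify y l in
      let k := eval cbn in (length l) in
      change (veval (fun i => nth i l (@vzero X)) s = veval (fun i => nth i l (@vzero X)) t);
      apply (veval_eq _ k); [reflexivity|];
      cbn [vcoefs_eq vcoef Nat.eqb]; repeat split
  end.
Ltac vec := vec_coefs; first [ring | field; lra].

(** * Norms and linear combinations *)

Lemma vnorm_0 {X : NormedSpace} : vnorm (@vzero X) = 0.
Proof. rewrite <- (vscal_0_l vzero), vnorm_scal, Rabs_R0. ring. Qed.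

Lemma vnorm_opp {X : NormedSpace} (x : X) : vnorm (vopp x) = vnorm x.
Proof.
  rewrite vopp_scal, vnorm_scal. rewrite Rabs_left; lra.
Qed.

Lemma vnorm_ge0 {X : NormedSpace} (x : X) : 0 <= vnorm x.
Proof.
  pose proof (vnorm_triangle X x (vopp x)) as H.
  rewrite vadd_opp, vnorm_0, vnorm_opp in H. lra.
Qed.

Lemma vnorm_sub {X : NormedSpace} (x y : X) : vnorm (x [-] y) <= vnorm x + vnorm y.
Proof. rewrite <- (vnorm_opp y). apply vnorm_triangle. Qed.

Lemma vnorm_scal_pos {X : NormedSpace} a (x : X) : 0 <= a -> vnorm (a [*] x) = a * vnorm x.
Proof. intros H. rewrite vnorm_scal, Rabs_right; lra. Qed.

Lemma lincomb_norm_le {X : NormedSpace} (c : nat -> R) (e : nat -> X) n C E :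
  0 <= C -> (forall i, (i < n)%nat -> Rabs (c i) <= C) ->
  (forall i, (i < n)%nat -> vnorm (e i) <= E) ->
  vnorm (lincomb c e n) <= INR n * (C * E).
Proof.
  intros HC. induction n as [|n IH]; intros Hc He.
  - simpl. rewrite vnorm_0. lra.
  - rewrite S_INR. simpl.
    pose proof (vnorm_triangle X (lincomb c e n) (c n [*] e n)) as H1.
    rewrite vnorm_scal in H1.
    assert (H2 : Rabs (c n) * vnorm (e n) <= C * E)
      by (apply Rmult_le_compat; auto using Rabs_pos, vnorm_ge0).
    assert (H3 : vnorm (lincomb c e n) <= INR n * (C * E)) by (apply IH; auto).
    lra.
Qed.

Lemma lincomb_sub {X : NormedSpace} (c c' : nat -> R) (e : nat -> X) n :
  lincomb (fun i => c i - c' i) e n = lincomb c e n [-] lincomb c' e n.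
Proof.
  rewrite (lincomb_ext _ (fun i => c i + -1 * c' i) e e n); [|intros; ring|reflexivity].
  rewrite lincomb_add, lincomb_scal. vec.
Qed.

(** * Averages along an arithmetic progression *)

Fixpoint vsum {X Y : NormedSpace} (a : X) (f : X -> Y) (m : nat) (x : X) : Y :=
  match m with
  | O => vzero
  | S k => vsum a f k x [+] f (x [+] INR k [*] a)
  end.

Definition average {X Y : NormedSpace} (m : nat) (a : X) (f : X -> Y) (x : X) : Y :=
  / INR m [*] vsum a f m x.

(** The functional Psi of the overview, over an arbitrary list of directions so that a single
    direction can be left out. *)
Fixpoint variation {X Y : NormedSpace} (l : list X) (f : X -> Y) (x : X) : R :=
  match l with
  | nil => 0
  | b :: l' => vnorm (f (x [+] b) [-] f x) + variation l' f x
  end.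

Lemma variation_app {X Y : NormedSpace} l1 l2 (f : X -> Y) x :
  variation (l1 ++ l2) f x = variation l1 f x + variation l2 f x.
Proof. induction l1 as [|b l1 IH]; simpl; [ring|rewrite IH; ring]. Qed.

Lemma variation_ge0 {X Y : NormedSpace} l (f : X -> Y) x : 0 <= variation l f x.
Proof.
  induction l as [|b l IH]; simpl; [lra|].
  pose proof (vnorm_ge0 (f (x [+] b) [-] f x)). lra.
Qed.

Lemma variation_le {X Y : NormedSpace} l (f : X -> Y) x C :
  (forall b, In b l -> vnorm (f (x [+] b) [-] f x) <= C) ->
  variation l f x <= INR (length l) * C.
Proof.
  induction l as [|b l IH]; intros H.
  - simpl. lra.
  - cbn [length variation]. rewrite S_INR.
    pose proof (H b (or_introl eq_refl)).
    assert (variation l f x <= INR (length l) * C) by (apply IH; intros; apply H; right; auto).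
    lra.
Qed.

Lemma variation_vsum_S {X Y : NormedSpace} l a (f : X -> Y) m x :
  variation l (vsum a f (S m)) x <=
  variation l (vsum a f m) x + variation l f (x [+] INR m [*] a).
Proof.
  induction l as [|b l IH]; [simpl; lra|].
  cbn [variation].
  pose proof (vnorm_triangle Y (vsum a f m (x [+] b) [-] vsum a f m x)
    (f (x [+] INR m [*] a [+] b) [-] f (x [+] INR m [*] a))) as H.
  replace (vsum a f (S m) (x [+] b) [-] vsum a f (S m) x) with
    (vsum a f m (x [+] b) [-] vsum a f m x [+]
    (f (x [+] INR m [*] a [+] b) [-] f (x [+] INR m [*] a))).
  - lra.
  - cbn [vsum]. replace (x [+] b [+] INR m [*] a) with (x [+] INR m [*] a [+] b) by vec. vec.
Qed.

Lemma variation_scal {X Y : NormedSpace} l c (f : X -> Y) x :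
  0 <= c -> variation l (fun z => c [*] f z) x = c * variation l f x.
Proof.
  intros Hc. induction l as [|b l IH]; simpl; [ring|].
  rewrite IH, Rmult_plus_distr_l. f_equal.
  rewrite <- vnorm_scal_pos by exact Hc. f_equal. vec.
Qed.

Lemma variation_vsum_le {X Y : NormedSpace} l a (f : X -> Y) m x B :
  (forall i, (i < m)%nat -> variation l f (x [+] INR i [*] a) <= B) ->
  variation l (vsum a f m) x <= INR m * B.
Proof.
  induction m as [|m IH]; intros H.
  - replace (INR 0 * B) with (INR (length l) * 0) by (simpl; ring).
    apply variation_le. intros b _. simpl. rewrite vadd_opp, vnorm_0. lra.
  - pose proof (variation_vsum_S l a f m x). rewrite S_INR.
    pose proof (H m (Nat.lt_succ_diag_r m)).
    assert (variation l (vsum a f m) x <= INR m * B) by (apply IH; intros; apply H; lia).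
    lra.
Qed.

(* The increments of [f] along the progression telescope, so their sum dominates the
   norm of the total increment. *)
Lemma variation_vsum_drop {X Y : NormedSpace} l a (f : X -> Y) m x B :
  (forall i, (i < m)%nat -> variation (a :: l) f (x [+] INR i [*] a) <= B) ->
  variation l (vsum a f m) x + vnorm (f (x [+] INR m [*] a) [-] f x) <= INR m * B.
Proof.
  induction m as [|m IH]; intros H.
  - assert (variation l (vsum a f 0) x <= INR 0 * 0) as H0.
    { replace (INR 0 * 0) with (INR (length l) * 0) by (simpl; ring).
      apply variation_le. intros b _. simpl. rewrite vadd_opp, vnorm_0. lra. }
    replace (f (x [+] INR 0 [*] a) [-] f x) with (@vzero Y).
    + rewrite vnorm_0. simpl in *. lra.
    + replace (x [+] INR 0 [*] a) with x by (simpl; vec). vec.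
  - pose proof (variation_vsum_S l a f m x). rewrite S_INR.
    pose proof (H m (Nat.lt_succ_diag_r m)) as Hm. cbn [variation] in Hm.
    assert (IHm := IH (fun i Hi => H i (Nat.lt_lt_succ_r _ _ Hi))).
    pose proof (vnorm_triangle Y (f (x [+] INR m [*] a) [-] f x)
      (f (x [+] INR m [*] a [+] a) [-] f (x [+] INR m [*] a))) as Ht.
    replace (f (x [+] (INR m + 1) [*] a) [-] f x) with
      (f (x [+] INR m [*] a) [-] f x [+]
      (f (x [+] INR m [*] a [+] a) [-] f (x [+] INR m [*] a))).
    + lra.
    + replace (x [+] (INR m + 1) [*] a) with (x [+] INR m [*] a [+] a) by vec. vec.
Qed.

Lemma vsum_sub_le {X Y : NormedSpace} a (f : X -> Y) m x y C :
  (forall i, (i < m)%nat ->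
    vnorm (f (x [+] INR i [*] a) [-] f (y [+] INR i [*] a)) <= C) ->
  vnorm (vsum a f m x [-] vsum a f m y) <= INR m * C.
Proof.
  induction m as [|m IH]; intros H.
  - simpl. rewrite vadd_opp, vnorm_0. lra.
  - rewrite S_INR. cbn [vsum].
    pose proof (H m (Nat.lt_succ_diag_r m)) as Hm.
    assert (IHm := IH (fun i Hi => H i (Nat.lt_lt_succ_r _ _ Hi))).
    pose proof (vnorm_triangle Y (vsum a f m x [-] vsum a f m y)
      (f (x [+] INR m [*] a) [-] f (y [+] INR m [*] a))) as Ht.
    match goal with |- vnorm ?u <= _ => replace u with (vsum a f m x [-] vsum a f m y [+]
      (f (x [+] INR m [*] a) [-] f (y [+] INR m [*] a))) by vec end.
    lra.
Qed.

Lemma vsum_near {X Y : NormedSpace} a (f : X -> Y) m x z C :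
  (forall i, (i < m)%nat -> vnorm (f (x [+] INR i [*] a) [-] z) <= C) ->
  vnorm (vsum a f m x [-] INR m [*] z) <= INR m * C.
Proof.
  induction m as [|m IH]; intros H.
  - simpl. replace (vzero [-] 0 [*] z) with (@vzero Y) by vec. rewrite vnorm_0. lra.
  - rewrite S_INR. cbn [vsum].
    pose proof (H m (Nat.lt_succ_diag_r m)) as Hm.
    assert (IHm := IH (fun i Hi => H i (Nat.lt_lt_succ_r _ _ Hi))).
    pose proof (vnorm_triangle Y (vsum a f m x [-] INR m [*] z)
      (f (x [+] INR m [*] a) [-] z)) as Ht.
    match goal with |- vnorm ?u <= _ => replace u with (vsum a f m x [-] INR m [*] z [+]
      (f (x [+] INR m [*] a) [-] z)) by vec end.
    lra.
Qed.

(** * Mixed second differences and their behaviour under averaging *)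

Definition diff2 {X Y : NormedSpace} (f : X -> Y) (a b x : X) : Y :=
  f (x [+] a [+] b) [-] f (x [+] a) [-] (f (x [+] b) [-] f x).

Lemma diff2_vsum_le {X Y : NormedSpace} v (f : X -> Y) m a b x C :
  (forall i, (i < m)%nat -> vnorm (diff2 f a b (x [+] INR i [*] v)) <= C) ->
  vnorm (diff2 (vsum v f m) a b x) <= INR m * C.
Proof.
  induction m as [|m IH]; intros H.
  - unfold diff2. simpl.
    replace (vzero [-] vzero [-] (vzero [-] vzero)) with (@vzero Y) by vec.
    rewrite vnorm_0. lra.
  - rewrite S_INR.
    pose proof (H m (Nat.lt_succ_diag_r m)) as Hm.
    assert (IHm := IH (fun i Hi => H i (Nat.lt_lt_succ_r _ _ Hi))).
    pose proof (vnorm_triangle Y (diff2 (vsum v f m) a b x)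
      (diff2 f a b (x [+] INR m [*] v))) as Ht.
    replace (diff2 (vsum v f (S m)) a b x) with
      (diff2 (vsum v f m) a b x [+] diff2 f a b (x [+] INR m [*] v)).
    + lra.
    + unfold diff2. cbn [vsum].
      replace (x [+] INR m [*] v [+] a [+] b) with (x [+] a [+] b [+] INR m [*] v) by vec.
      replace (x [+] INR m [*] v [+] a) with (x [+] a [+] INR m [*] v) by vec.
      replace (x [+] INR m [*] v [+] b) with (x [+] b [+] INR m [*] v) by vec.
      vec.
Qed.

Lemma vsum_shift {X Y : NormedSpace} a (f : X -> Y) m x :
  vsum a f m (x [+] a) [-] vsum a f m x = f (x [+] INR m [*] a) [-] f x.
Proof.
  induction m as [|m IH].
  - simpl. replace (x [+] 0 [*] a) with x by vec. vec.
  - rewrite S_INR. cbn [vsum].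
    replace (x [+] a [+] INR m [*] a) with (x [+] (INR m + 1) [*] a) by vec.
    transitivity (vsum a f m (x [+] a) [-] vsum a f m x [+]
      (f (x [+] (INR m + 1) [*] a) [-] f (x [+] INR m [*] a))); [vec|].
    rewrite IH. vec.
Qed.

(** Differencing in the direction of the sum telescopes. The four remaining terms regroup into two
    increments by [b], at the two ends of the progression, so the average has second differences of
    order 1/m. *)
Lemma diff2_vsum {X Y : NormedSpace} a (f : X -> Y) m b x :
  diff2 (vsum a f m) a b x =
  f (x [+] b [+] INR m [*] a) [-] f (x [+] b) [-] (f (x [+] INR m [*] a) [-] f x).
Proof.
  rewrite <- !vsum_shift. unfold diff2.
  replace (x [+] b [+] a) with (x [+] a [+] b) by vec. vec.
Qed.

Lemma diff2_scal {X Y : NormedSpace} c (f : X -> Y) a b x :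
  diff2 (fun z => c [*] f z) a b x = c [*] diff2 f a b x.
Proof. unfold diff2. vec. Qed.

Lemma vnorm_scal_inv_le {X : NormedSpace} m (z : X) C :
  (0 < m)%nat -> vnorm z <= INR m * C -> vnorm (/ INR m [*] z) <= C.
Proof.
  intros Hm H. apply lt_0_INR in Hm.
  pose proof (Rinv_0_lt_compat _ Hm).
  rewrite vnorm_scal_pos by lra.
  apply Rmult_le_reg_l with (INR m); [exact Hm|].
  rewrite <- Rmult_assoc, Rinv_r by lra. lra.
Qed.

(** * Locating a point where an averaged map is nearly affine *)

Section Averaging.

Variables (X Y : NormedSpace) (F : X -> Y) (A : list X) (D dl W Rad : R) (M : nat).
Hypothesis HA : forall a, In a A -> vnorm a <= W.
Hypothesis HW : 1 <= W.
Hypothesis HD : 1 <= D.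
Hypothesis Hdl : 0 <= dl <= 1 / 2.
Hypothesis HM : 9 * (D * W) <= INR M.
Hypothesis HF : forall x y, vnorm x <= Rad -> vnorm y <= Rad ->
  vnorm (x [-] y) - dl <= vnorm (F x [-] F y) <= D * vnorm (x [-] y) + dl.

(** Here [m] is the length of the next average. Being within [INR m / 4] of [F] at both ends of a
    progression of that length changes its total increment by at most [INR m / 2]. *)
Definition tame (m : nat) (f : X -> Y) : Prop :=
  (forall x y, vnorm x <= Rad - W * INR m -> vnorm y <= Rad - W * INR m ->
    vnorm (f x [-] f y) <= D * vnorm (x [-] y) + dl) /\
  (forall x, vnorm x <= Rad - W * INR m -> vnorm (f x [-] F x) <= INR m / 4).

(** The margin [2 * W] leaves room for two further steps by vectors of norm at most [W];
    [diff2_bound] uses the same domain. *)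
Definition variation_bound (l : list X) (m : nat) (f : X -> Y) (B : R) : Prop :=
  forall x, vnorm x <= Rad - W * INR m - 2 * W -> variation l f x <= B.

Definition diff2_bound (a b : X) (m : nat) (f : X -> Y) (C : R) : Prop :=
  forall x, vnorm x <= Rad - W * INR m - 2 * W -> vnorm (diff2 f a b x) <= C.

Lemma DW_ge1 : 1 <= D * W.
Proof. rewrite <- (Rmult_1_l 1). apply Rmult_le_compat; lra. Qed.

Lemma tame_refl m : tame m F.
Proof.
  assert (HWm : 0 <= W * INR m) by (apply Rmult_le_pos; [lra|apply pos_INR]).
  split.
  - intros x y Hx Hy. apply HF; lra.
  - intros x _. rewrite vadd_opp, vnorm_0. pose proof (pos_INR m). lra.
Qed.

Lemma progression_norm a x i m :
  In a A -> (i <= m)%nat -> vnorm (x [+] INR i [*] a) <= vnorm x + W * INR m.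
Proof.
  intros Ha Hi. pose proof (vnorm_triangle X x (INR i [*] a)) as H.
  rewrite vnorm_scal_pos in H by apply pos_INR.
  apply le_INR in Hi.
  assert (INR i * vnorm a <= INR m * W)
    by (apply Rmult_le_compat; auto using pos_INR, vnorm_ge0).
  lra.
Qed.

(** The domain at scale [M * m] is smaller than that at scale [m] by at least [W * INR m], which is
    the room taken by a progression of [m] steps. *)
Lemma radius_step m : (0 < m)%nat -> 2 * (W * INR m) <= W * INR (M * m).
Proof.
  intros Hm. apply lt_0_INR in Hm. pose proof DW_ge1. rewrite mult_INR.
  assert (2 * INR m <= INR M * INR m) by (apply Rmult_le_compat_r; lra).
  assert (W * (2 * INR m) <= W * (INR M * INR m)) by (apply Rmult_le_compat_l; lra).
  lra.
Qed.

(** The Lipschitz bound passes to averages. Along the progression [f] moves by at most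
    [D * (W * INR m) + dl], so the distance to [F] stays below a quarter of the new scale because
    [M] is at least [9 * (D * W)]. *)
Lemma tame_average m a f : (0 < m)%nat -> In a A -> tame m f -> tame (M * m) (average m a f).
Proof.
  intros Hm Ha [Hf1 Hf2].
  pose proof (radius_step m Hm) as Hr.
  assert (Hball : forall x i, vnorm x <= Rad - W * INR (M * m) -> (i <= m)%nat ->
    vnorm (x [+] INR i [*] a) <= Rad - W * INR m).
  { intros x i Hx Hi. pose proof (progression_norm a x i m Ha Hi). lra. }
  split.
  - intros x y Hx Hy. unfold average.
    replace (/ INR m [*] vsum a f m x [-] / INR m [*] vsum a f m y) with
      (/ INR m [*] (vsum a f m x [-] vsum a f m y)) by vec.
    apply vnorm_scal_inv_le; [exact Hm|].
    apply vsum_sub_le. intros i Hi.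
    replace (x [-] y) with (x [+] INR i [*] a [-] (y [+] INR i [*] a)) by vec.
    apply Hf1; apply Hball; auto with arith.
  - intros x Hx. unfold average.
    assert (Hm' : 0 < INR m) by (apply lt_0_INR; exact Hm).
    replace (/ INR m [*] vsum a f m x [-] F x) with
      (/ INR m [*] (vsum a f m x [-] INR m [*] F x)) by vec.
    apply vnorm_scal_inv_le; [exact Hm|].
    apply vsum_near. intros i Hi.
    pose proof (vnorm_triangle Y (f (x [+] INR i [*] a) [-] f x) (f x [-] F x)) as Ht.
    replace (f (x [+] INR i [*] a) [-] f x [+] (f x [-] F x)) with
      (f (x [+] INR i [*] a) [-] F x) in Ht by vec.
    assert (Hx' : vnorm x <= Rad - W * INR m).
    { assert (0 <= W * INR m) by (apply Rmult_le_pos; lra). lra. }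
    pose proof (Hf2 x Hx') as H2.
    assert (Hi' : (i <= m)%nat) by lia.
    pose proof (Hf1 _ x (Hball x i Hx Hi') Hx') as H1.
    replace (x [+] INR i [*] a [-] x) with (INR i [*] a) in H1 by vec.
    rewrite vnorm_scal_pos in H1 by apply pos_INR.
    assert (H3 : INR i * vnorm a <= INR m * W)
      by (apply Rmult_le_compat; auto using pos_INR, vnorm_ge0, le_INR).
    assert (H4 : D * (INR i * vnorm a) <= D * (INR m * W)) by (apply Rmult_le_compat_l; lra).
    rewrite mult_INR.
    assert (H5 : 9 * (D * W) * INR m <= INR M * INR m) by (apply Rmult_le_compat_r; lra).
    assert (H6 : 1 * INR m <= D * W * INR m) by (apply Rmult_le_compat_r; [lra|apply DW_ge1]).
    assert (H7 : 1 <= INR m) by (apply (le_INR 1); exact Hm).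
    lra.
Qed.

(** The variation is convex in the map, so that of an average is at most the mean of the variations
    along the progression. *)
Lemma variation_bound_average m a l f B :
  (0 < m)%nat -> In a A -> variation_bound l m f B ->
  variation_bound l (M * m) (average m a f) B.
Proof.
  intros Hm Ha Hf x Hx. pose proof (radius_step m Hm) as Hr.
  assert (Hm' : 0 < INR m) by (apply lt_0_INR; exact Hm).
  unfold average. rewrite variation_scal by (left; apply Rinv_0_lt_compat; exact Hm').
  apply Rmult_le_reg_l with (INR m); [exact Hm'|].
  rewrite <- Rmult_assoc, Rinv_r, Rmult_1_l by lra.
  apply variation_vsum_le. intros i Hi. apply Hf.
  pose proof (progression_norm a x i m Ha (Nat.lt_le_incl _ _ Hi)). lra.
Qed.

(** The terms with direction [a] dominate the increment of [f] over the whole progression. For [F]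
    this increment is at least [INR m * vnorm a - dl]; passing to [f] costs [INR m / 2] and [dl] is
    at most 1/2, so the gain per step is at least [vnorm a - 1]. *)
Lemma variation_bound_average_drop m a l1 l2 f B :
  (0 < m)%nat -> In a A -> tame m f -> variation_bound (l1 ++ a :: l2) m f B ->
  variation_bound (l1 ++ l2) (M * m) (average m a f) (B - vnorm a + 1).
Proof.
  intros Hm Ha [_ Hd] Hf x Hx. pose proof (radius_step m Hm) as Hr.
  assert (Hm' : 1 <= INR m) by (apply (le_INR 1); exact Hm).
  unfold average. rewrite variation_scal by (left; apply Rinv_0_lt_compat; lra).
  apply Rmult_le_reg_l with (INR m); [lra|].
  rewrite <- Rmult_assoc, Rinv_r, Rmult_1_l by lra.
  assert (HWm : 0 <= W * INR m) by (apply Rmult_le_pos; lra).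
  pose proof (progression_norm a x m m Ha (Nat.le_refl m)) as Hxm.
  set (x' := x [+] INR m [*] a) in *.
  assert (Hdrop : variation (l1 ++ l2) (vsum a f m) x + vnorm (f x' [-] f x) <= INR m * B).
  { apply variation_vsum_drop. intros i Hi.
    pose proof (progression_norm a x i m Ha (Nat.lt_le_incl _ _ Hi)).
    assert (H1 : variation (l1 ++ a :: l2) f (x [+] INR i [*] a) <= B) by (apply Hf; lra).
    rewrite variation_app in H1. cbn [variation] in *. rewrite variation_app. lra. }
  assert (H1 : vnorm (f x [-] F x) <= INR m / 4) by (apply Hd; lra).
  assert (H2 : vnorm (f x' [-] F x') <= INR m / 4) by (apply Hd; lra).
  assert (H3 : vnorm (x' [-] x) - dl <= vnorm (F x' [-] F x)) by (apply HF; lra).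
  replace (x' [-] x) with (INR m [*] a) in H3 by (unfold x'; vec).
  rewrite vnorm_scal_pos in H3 by lra.
  pose proof (vnorm_triangle Y (f x' [-] f x [-] (f x' [-] F x')) (f x [-] F x)) as H4.
  replace (f x' [-] f x [-] (f x' [-] F x') [+] (f x [-] F x)) with (F x' [-] F x) in H4 by vec.
  pose proof (vnorm_sub (f x' [-] f x) (f x' [-] F x')).
  lra.
Qed.

Lemma diff2_bound_average m v a b f C :
  (0 < m)%nat -> In v A -> diff2_bound a b m f C ->
  diff2_bound a b (M * m) (average m v f) C.
Proof.
  intros Hm Hv Hf x Hx. pose proof (radius_step m Hm) as Hr.
  unfold average. rewrite diff2_scal. apply vnorm_scal_inv_le; [exact Hm|].
  apply diff2_vsum_le. intros i Hi. apply Hf.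
  pose proof (progression_norm v x i m Hv (Nat.lt_le_incl _ _ Hi)). lra.
Qed.

(** Only two increments by [b] survive, each at most [D * W + dl], and they are divided by [m],
    which is at least [m0]. *)
Lemma diff2_bound_average_same m m0 a b f C :
  (0 < m0 <= m)%nat -> In a A -> vnorm b <= W -> tame m f ->
  3 * (D * W) <= INR m0 * C ->
  diff2_bound a b (M * m) (average m a f) C.
Proof.
  intros Hm Ha Hb [Hf _] HC x Hx.
  assert (Hm' : (0 < m)%nat) by lia.
  pose proof (radius_step m Hm') as Hr.
  unfold average. rewrite diff2_scal. apply vnorm_scal_inv_le; [exact Hm'|].
  rewrite diff2_vsum.
  assert (HWm : 0 <= W * INR m) by (apply Rmult_le_pos; [lra|apply pos_INR]).
  pose proof (progression_norm a x m m Ha (Nat.le_refl m)) as H1.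
  pose proof (vnorm_triangle X (x [+] INR m [*] a) b) as H2.
  pose proof (vnorm_triangle X x b) as H3.
  assert (HDb : D * vnorm b <= D * W) by (apply Rmult_le_compat_l; lra).
  assert (H4 : vnorm (f (x [+] INR m [*] a [+] b) [-] f (x [+] INR m [*] a)) <= D * vnorm b + dl).
  { replace b with (x [+] INR m [*] a [+] b [-] (x [+] INR m [*] a)) at 2 by vec.
    apply Hf; lra. }
  assert (H5 : vnorm (f (x [+] b) [-] f x) <= D * vnorm b + dl).
  { replace b with (x [+] b [-] x) at 2 by vec. apply Hf; lra. }
  replace (x [+] b [+] INR m [*] a) with (x [+] INR m [*] a [+] b) by vec.
  replace (f (x [+] INR m [*] a [+] b) [-] f (x [+] b) [-] (f (x [+] INR m [*] a) [-] f x))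
    with (f (x [+] INR m [*] a [+] b) [-] f (x [+] INR m [*] a) [-] (f (x [+] b) [-] f x)) by vec.
  pose proof (vnorm_sub (f (x [+] INR m [*] a [+] b) [-] f (x [+] INR m [*] a))
    (f (x [+] b) [-] f x)) as H6.
  pose proof DW_ge1.
  assert (H7 : 0 < INR m0) by (apply lt_0_INR; lia).
  assert (H8 : INR m0 <= INR m) by (apply le_INR; lia).
  assert (HC0 : 0 <= C).
  { apply Rmult_le_reg_l with (INR m0); [exact H7|]. lra. }
  assert (INR m0 * C <= INR m * C) by (apply Rmult_le_compat_r; lra).
  lra.
Qed.

(** * Successive averages along a whole list of directions, at growing scales *)

Fixpoint average_along (l : list X) (m : nat) (f : X -> Y) : X -> Y :=
  match l with
  | nil => f
  | a :: l' => average_along l' (M * m) (average m a f)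
  end.

Fixpoint scale_after (l : list X) (m : nat) : nat :=
  match l with
  | nil => m
  | _ :: l' => scale_after l' (M * m)
  end.

Lemma M_pos : (0 < M)%nat.
Proof. apply INR_lt. simpl. pose proof DW_ge1. lra. Qed.

Lemma scale_after_eq l m : scale_after l m = (M ^ length l * m)%nat.
Proof.
  revert m. induction l as [|a l IH]; intros m; simpl; [lia|]. rewrite IH. lia.
Qed.

Lemma scale_step_ge m : (m <= M * m)%nat.
Proof. pose proof M_pos. nia. Qed.

Lemma average_along_tame l m f :
  (0 < m)%nat -> incl l A -> tame m f -> tame (scale_after l m) (average_along l m f).
Proof.
  revert m f. induction l as [|a l IH]; intros m f Hm Hl Hf; simpl; [exact Hf|].
  apply incl_cons_inv in Hl. destruct Hl as [Ha Hl].
  pose proof (scale_step_ge m).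
  apply IH; [lia|exact Hl|]. apply tame_average; auto.
Qed.

Lemma average_along_variation S l m f B :
  (0 < m)%nat -> incl l A -> variation_bound S m f B ->
  variation_bound S (scale_after l m) (average_along l m f) B.
Proof.
  revert m f. induction l as [|a l IH]; intros m f Hm Hl Hf; simpl; [exact Hf|].
  apply incl_cons_inv in Hl. destruct Hl as [Ha Hl].
  pose proof (scale_step_ge m).
  apply IH; [lia|exact Hl|]. apply variation_bound_average; auto.
Qed.

Lemma average_along_diff2 a b l m f C :
  (0 < m)%nat -> incl l A -> diff2_bound a b m f C ->
  diff2_bound a b (scale_after l m) (average_along l m f) C.
Proof.
  revert m f. induction l as [|v l IH]; intros m f Hm Hl Hf; simpl; [exact Hf|].
  apply incl_cons_inv in Hl. destruct Hl as [Hv Hl].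
  pose proof (scale_step_ge m).
  apply IH; [lia|exact Hl|]. apply diff2_bound_average; auto.
Qed.

(** Before the turn of [a] the full bound persists, at its turn the bound drops, and later averages
    preserve the reduced bound. *)
Lemma average_along_drop a l1 l2 l m f B :
  (0 < m)%nat -> incl l A -> In a l -> tame m f -> variation_bound (l1 ++ a :: l2) m f B ->
  variation_bound (l1 ++ l2) (scale_after l m) (average_along l m f) (B - vnorm a + 1).
Proof.
  revert m f. induction l as [|v l IH]; intros m f Hm Hl Hin Hf HB; [destruct Hin|].
  apply incl_cons_inv in Hl. destruct Hl as [Hv Hl].
  pose proof (scale_step_ge m). simpl.
  destruct Hin as [->|Hin].
  - apply average_along_variation; [lia|exact Hl|].
    apply variation_bound_average_drop; auto.
  - apply IH; [lia|exact Hl|exact Hin| |].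
    + apply tame_average; auto.
    + apply variation_bound_average; auto.
Qed.

(** The average in direction [a] makes the second difference small and later averages keep it so.
    Tying [C] to the initial scale [m0] makes the same bound valid in every pass. *)
Lemma average_along_diff2_small m0 a b l m f C :
  (0 < m0 <= m)%nat -> incl l A -> In a l -> vnorm b <= W -> tame m f ->
  3 * (D * W) <= INR m0 * C ->
  diff2_bound a b (scale_after l m) (average_along l m f) C.
Proof.
  revert m f. induction l as [|v l IH]; intros m f Hm Hl Hin Hb Hf HC; [destruct Hin|].
  apply incl_cons_inv in Hl. destruct Hl as [Hv Hl].
  pose proof (scale_step_ge m). simpl.
  destruct Hin as [->|Hin].
  - apply average_along_diff2; [lia|exact Hl|].
    apply diff2_bound_average_same with m0; auto.
  - apply IH; auto; [lia|]. apply tame_average; auto. lia.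
Qed.

(* Each pass through [A] that does not produce the desired point lowers the supremum of
   the variation by [1], which can happen at most [K] times. *)
Lemma nearly_affine_point m0 C K : forall m f B,
  (0 < m0 <= m)%nat -> 3 * (D * W) <= INR m0 * C ->
  tame m f -> variation_bound A m f B -> B < INR K ->
  W * INR (M ^ (length A * K) * m) + 2 * W <= Rad ->
  exists (G : X -> Y) (x : X),
    (forall b c, vnorm b <= W -> vnorm c <= W ->
      vnorm (G (x [+] b) [-] G (x [+] c)) <= D * vnorm (b [-] c) + dl) /\
    (forall a b, In a A -> vnorm b <= W -> vnorm (diff2 G a b x) <= C) /\
    (forall a, In a A -> vnorm a - 2 <= vnorm (G (x [+] a) [-] G x)).
Proof.
  induction K as [|K IH]; intros m f B Hm HC Hf HB HBK HR.
  (* With no passes left [B] is negative, contradicting nonnegativity of the variation at the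
     origin, which lies in the domain by [HR]. *)
  - exfalso. rewrite Nat.mul_0_r in HR. simpl in HR. rewrite Nat.add_0_r in HR.
    assert (H := HB vzero). rewrite vnorm_0 in H.
    pose proof (variation_ge0 A f vzero). simpl in HBK. lra.
  - assert (Hm' : (0 < m)%nat) by lia.
    pose proof (average_along_tame A m f Hm' (incl_refl A) Hf) as Hf'.
    pose proof (average_along_diff2_small m0) as HS.
    pose proof (fun a l1 l2 => average_along_drop a l1 l2 A m f B Hm' (incl_refl A)) as Hdrop.
    set (G := average_along A m f) in *.
    set (m' := scale_after A m) in *.
    destruct (classic (variation_bound A m' G (B - 1))) as [HG|HG].
    + apply (IH m' G (B - 1)).
      * unfold m'. rewrite scale_after_eq.
        pose proof (Nat.pow_nonzero M (length A)). pose proof M_pos. nia.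
      * exact HC.
      * exact Hf'.
      * exact HG.
      * rewrite S_INR in HBK. lra.
      * unfold m'. rewrite scale_after_eq, Nat.mul_assoc, <- Nat.pow_add_r.
        replace (length A * K + length A)%nat with (length A * S K)%nat by lia. exact HR.
    + apply not_all_ex_not in HG. destruct HG as [x HG].
      apply imply_to_and in HG. destruct HG as [Hx HG].
      apply Rnot_le_lt in HG.
      exists G, x. split; [|split].
      * intros b c Hb Hc.
        pose proof (vnorm_triangle X x b). pose proof (vnorm_triangle X x c).
        replace (b [-] c) with (x [+] b [-] (x [+] c)) by vec.
        apply Hf'; lra.
      * intros a b Ha Hb. apply (HS a b A m f C); auto. apply incl_refl.
      (* At [x] the variation over all of [A] exceeds [B - 1], while without [a] it is at most
         [B - vnorm a + 1]; the difference is the increment in direction [a]. *)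
      * intros a Ha. destruct (in_split a A Ha) as [l1 [l2 HAl]].
        assert (HA' : variation_bound (l1 ++ a :: l2) m f B) by (rewrite <- HAl; exact HB).
        pose proof (Hdrop a l1 l2 Ha Hf HA' x Hx) as H1.
        rewrite HAl, variation_app in HG. rewrite variation_app in H1.
        cbn [variation] in HG. lra.
Qed.

End Averaging.

(** * From a nearly affine point to a linear embedding *)

Fixpoint lattice_box {X : NormedSpace} (e : nat -> X) (P n : nat) : list X :=
  match n with
  | O => vzero :: nil
  | S k => flat_map (fun v =>
      map (fun j => v [+] (INR j - INR P) [*] e k) (seq 0 (2 * P + 1))) (lattice_box e P k)
  end.

Lemma lattice_box_length {X : NormedSpace} (e : nat -> X) P n :
  length (lattice_box e P n) = ((2 * P + 1) ^ n)%nat.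
Proof.
  induction n as [|n IH]; [reflexivity|]. cbn [lattice_box].
  rewrite (flat_map_constant_length (c := (2 * P + 1)%nat)).
  - rewrite IH. cbn [Nat.pow]. lia.
  - intros v _. rewrite length_map, length_seq. reflexivity.
Qed.

Lemma lattice_box_in {X : NormedSpace} (e : nat -> X) P n (z : nat -> Z) :
  (forall i, (i < n)%nat -> Rabs (IZR (z i)) <= INR P) ->
  In (lincomb (fun i => IZR (z i)) e n) (lattice_box e P n).
Proof.
  induction n as [|n IH]; intros Hz; [left; reflexivity|].
  cbn [lattice_box lincomb]. apply in_flat_map.
  exists (lincomb (fun i => IZR (z i)) e n). split; [apply IH; auto|].
  apply in_map_iff. pose proof (Hz n (Nat.lt_succ_diag_r n)) as Hn.
  rewrite <- abs_IZR, INR_IZR_INZ in Hn. apply le_IZR in Hn.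
  exists (Z.to_nat (z n + Z.of_nat P)). split.
  - f_equal. f_equal. rewrite !INR_IZR_INZ, <- minus_IZR. f_equal. lia.
  - apply in_seq. lia.
Qed.

Lemma lattice_box_norm {X : NormedSpace} (e : nat -> X) P n v :
  (forall i, (i < n)%nat -> vnorm (e i) <= 1) ->
  In v (lattice_box e P n) -> vnorm v <= INR n * INR P.
Proof.
  intros He. revert v. induction n as [|n IH]; intros v Hv.
  - destruct Hv as [<-|[]]. rewrite vnorm_0. simpl. lra.
  - cbn [lattice_box] in Hv. apply in_flat_map in Hv. destruct Hv as [w [Hw Hv]].
    apply in_map_iff in Hv. destruct Hv as [j [<- Hj]]. apply in_seq in Hj.
    assert (IHw : vnorm w <= INR n * INR P) by (apply IH; auto).
    pose proof (vnorm_triangle X w ((INR j - INR P) [*] e n)) as Ht.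
    rewrite vnorm_scal in Ht.
    assert (H1 : Rabs (INR j - INR P) <= INR P).
    { apply Rabs_le. pose proof (pos_INR j).
      assert (INR j <= 2 * INR P).
      { change 2 with (INR 2). rewrite <- mult_INR. apply le_INR. lia. }
      lra. }
    assert (H2 : Rabs (INR j - INR P) * vnorm (e n) <= INR P * 1)
      by (apply Rmult_le_compat; auto using Rabs_pos, vnorm_ge0).
    rewrite S_INR. lra.
Qed.

(** * Increments along lattice paths *)

Section Walk.

Variables (X Y : NormedSpace) (G : X -> Y) (x : X) (C W : R).

Lemma walk_nat e y (j : nat) w :
  vnorm e <= 1 ->
  (forall b, vnorm b <= W -> vnorm (G (x [+] (b [+] e)) [-] G (x [+] b) [-] y) <= C) ->
  vnorm w + INR j <= W ->
  vnorm (G (x [+] (w [+] INR j [*] e)) [-] G (x [+] w) [-] INR j [*] y) <= INR j * C.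
Proof.
  intros He Hstep. induction j as [|j IH]; intros Hw.
  - simpl. replace (w [+] 0 [*] e) with w by vec.
    replace (G (x [+] w) [-] G (x [+] w) [-] 0 [*] y) with (@vzero Y) by vec.
    rewrite vnorm_0. lra.
  - rewrite S_INR in *.
    assert (IHj := IH ltac:(lra)).
    assert (Hb : vnorm (w [+] INR j [*] e) <= W).
    { pose proof (vnorm_triangle X w (INR j [*] e)) as Ht.
      rewrite vnorm_scal_pos in Ht by apply pos_INR.
      assert (INR j * vnorm e <= INR j * 1) by (apply Rmult_le_compat_l; auto using pos_INR).
      lra. }
    apply Hstep in Hb.
    replace (w [+] INR j [*] e [+] e) with (w [+] (INR j + 1) [*] e) in Hb by vec.
    match type of Hb with vnorm ?s <= _ => match type of IHj with vnorm ?t <= _ =>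
      pose proof (vnorm_triangle Y t s) as Ht;
      match goal with |- vnorm ?u <= _ => replace u with (t [+] s) by vec end
    end end.
    lra.
Qed.

(** For negative [z] the walk goes forwards from the endpoint to [w]. The norm of that endpoint plus
    the length of the walk accounts for the factor 2 in the room required. *)
Lemma walk_Z e y (z : Z) w :
  vnorm e <= 1 ->
  (forall b, vnorm b <= W -> vnorm (G (x [+] (b [+] e)) [-] G (x [+] b) [-] y) <= C) ->
  vnorm w + 2 * Rabs (IZR z) <= W ->
  vnorm (G (x [+] (w [+] IZR z [*] e)) [-] G (x [+] w) [-] IZR z [*] y) <= Rabs (IZR z) * C.
Proof.
  intros He Hstep Hw.
  destruct (Z.le_gt_cases 0 z) as [Hz|Hz].
  - assert (Ez : IZR z = INR (Z.to_nat z)) by (rewrite INR_IZR_INZ; f_equal; lia).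
    rewrite Ez in *. rewrite Rabs_right in * by (apply Rle_ge, pos_INR).
    pose proof (pos_INR (Z.to_nat z)).
    apply walk_nat; auto. lra.
  - assert (Ez : IZR z = - INR (Z.to_nat (- z))).
    { rewrite INR_IZR_INZ, <- opp_IZR. f_equal. lia. }
    rewrite Ez in *. set (j := Z.to_nat (- z)) in *.
    rewrite Rabs_Ropp, Rabs_right in * by (apply Rle_ge, pos_INR).
    pose proof (walk_nat e y j (w [+] - INR j [*] e) He Hstep) as H.
    replace (w [+] - INR j [*] e [+] INR j [*] e) with w in H by vec.
    rewrite <- vnorm_opp.
    match goal with |- vnorm ?u <= _ =>
      replace u with (G (x [+] w) [-] G (x [+] (w [+] - INR j [*] e)) [-] INR j [*] y) by vec end.
    apply H.
    pose proof (vnorm_triangle X w (- INR j [*] e)) as Ht.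
    rewrite vnorm_scal, Rabs_Ropp, Rabs_right in Ht by (apply Rle_ge, pos_INR).
    assert (INR j * vnorm e <= INR j * 1) by (apply Rmult_le_compat_l; auto using pos_INR).
    lra.
Qed.

(** Small second differences make the increment along each [e i] nearly independent of the base
    point. A lattice vector is reached one coordinate at a time, with an error of at most [C] per
    unit step. *)
Lemma walk_lattice (e : nat -> X) n P (z : nat -> Z) k :
  (forall i, (i < n)%nat -> vnorm (e i) <= 1) ->
  (forall i b, (i < n)%nat -> vnorm b <= W -> vnorm (diff2 G (e i) b x) <= C) ->
  (forall i, (i < n)%nat -> Rabs (IZR (z i)) <= P) ->
  0 <= C -> 3 * (INR n * P) <= W -> (k <= n)%nat ->
  vnorm (G (x [+] lincomb (fun i => IZR (z i)) e k) [-] G x [-]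
    lincomb (fun i => IZR (z i)) (fun i => G (x [+] e i) [-] G x) k) <= INR k * P * C.
Proof.
  intros He Hd Hz HC HW. induction k as [|k IH]; intros Hk.
  - simpl. replace (x [+] vzero) with x by vec.
    replace (G x [-] G x [-] vzero) with (@vzero Y) by vec. rewrite vnorm_0. lra.
  - assert (IHk := IH ltac:(lia)). rewrite S_INR. cbn [lincomb].
    assert (HP : 0 <= P) by (pose proof (Hz k Hk); pose proof (Rabs_pos (IZR (z k))); lra).
    assert (Hw : vnorm (lincomb (fun i => IZR (z i)) e k) <= INR k * (P * 1)).
    { apply lincomb_norm_le; [exact HP| |]; intros; [apply Hz|apply He]; lia. }
    assert (Hkn : INR (S k) <= INR n) by (apply le_INR; exact Hk).
    rewrite S_INR in Hkn. pose proof (pos_INR k).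
    assert ((INR k + 1) * P <= INR n * P) by (apply Rmult_le_compat_r; lra).
    assert (0 <= INR k * P) by (apply Rmult_le_pos; lra).
    pose proof (Hz k Hk) as Hzk.
    set (w := lincomb (fun i => IZR (z i)) e k) in *.
    assert (Hlast : vnorm (G (x [+] (w [+] IZR (z k) [*] e k)) [-] G (x [+] w) [-]
      IZR (z k) [*] (G (x [+] e k) [-] G x)) <= Rabs (IZR (z k)) * C).
    { apply walk_Z; [auto| |lra]. intros b Hb.
      pose proof (Hd k b Hk Hb) as Hdk. unfold diff2 in Hdk.
      replace (x [+] e k [+] b) with (x [+] (b [+] e k)) in Hdk by vec.
      match goal with |- vnorm ?u <= _ => match type of Hdk with vnorm ?v <= _ =>
        replace u with v by vec end end.
      exact Hdk. }
    assert (Rabs (IZR (z k)) * C <= P * C) by (apply Rmult_le_compat_r; lra).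
    match type of IHk with vnorm ?s <= _ => match type of Hlast with vnorm ?t <= _ =>
      pose proof (vnorm_triangle Y s t) as Ht;
      match goal with |- vnorm ?u <= _ => replace u with (s [+] t) by vec end
    end end.
    lra.
Qed.

End Walk.

(** An Auerbach basis, except that the coordinate functionals may have norm up to 2 instead of 1; a
    determinant then has to be maximized only up to a factor 2. *)
Definition near_auerbach {X : NormedSpace} (e : nat -> X) (n : nat) : Prop :=
  (forall i, (i < n)%nat -> vnorm (e i) <= 1) /\
  (forall c i, (i < n)%nat -> Rabs (c i) <= 2 * vnorm (lincomb c e n)).

(** A vector of norm [L] is rounded to a lattice vector. Rounding costs at most [INR n] in [X] and
    [2 * INR n * D] in [Y], the walk at most 1, and the bounds on increments at most 2 below and
    [dl] above. Everything fits into [6 * (INR n * D)], with a further factor [D] in the upper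
    bound. *)
Lemma derivative_bounds {X Y : NormedSpace} (e : nat -> X) n (G : X -> Y) x D dl W C P L :
  near_auerbach e n -> (1 <= n)%nat ->
  1 <= D -> 0 <= dl <= 1 / 2 -> 0 <= C -> INR n * INR P * C <= 1 ->
  2 * L + 1 <= INR P -> 3 * (INR n * INR P) <= W ->
  (forall b c, vnorm b <= W -> vnorm c <= W ->
    vnorm (G (x [+] b) [-] G (x [+] c)) <= D * vnorm (b [-] c) + dl) ->
  (forall a b, In a (lattice_box e P n) -> vnorm b <= W -> vnorm (diff2 G a b x) <= C) ->
  (forall a, In a (lattice_box e P n) -> vnorm a - 2 <= vnorm (G (x [+] a) [-] G x)) ->
  forall c, vnorm (lincomb c e n) = L ->
    L - 6 * (INR n * D) <= vnorm (lincomb c (fun i => G (x [+] e i) [-] G x) n) <=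
      D * (L + 6 * (INR n * D)).
Proof.
  intros [He Hc] Hn HD Hdl HC HPC HLP HPW Hup Hd2 Hlow c HL.
  set (y := fun i => G (x [+] e i) [-] G x).
  assert (HL0 : 0 <= L) by (rewrite <- HL; apply vnorm_ge0).
  apply (le_INR 1) in Hn as Hn'. simpl in Hn'.
  assert (HnD : 1 * 1 <= INR n * D) by (apply Rmult_le_compat; lra).
  assert (HnD' : INR n * 1 <= INR n * D) by (apply Rmult_le_compat_l; lra).
  assert (HnP : 1 * INR P <= INR n * INR P) by (apply Rmult_le_compat_r; lra).
  assert (HDnD : 1 * (INR n * D) <= D * (INR n * D)) by (apply Rmult_le_compat_r; lra).
  (* The basis vectors are themselves lattice points, so [Hd2] covers their directions. *)
  assert (Hunit : forall i, (i < n)%nat -> In (e i) (lattice_box e P n)).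
  { intros i Hi.
    rewrite <- (lincomb_unit e n i Hi).
    rewrite (lincomb_ext _ (fun j => IZR (if Nat.eqb i j then 1 else 0)%Z) e e).
    - apply lattice_box_in. intros j _. destruct (Nat.eqb i j).
      + rewrite Rabs_R1. lra.
      + rewrite Rabs_R0. lra.
    - intros j _. destruct (Nat.eqb i j); reflexivity.
    - reflexivity. }
  assert (H0W : vnorm (@vzero X) <= W) by (rewrite vnorm_0; lra).
  assert (Hy : forall i, (i < n)%nat -> vnorm (y i) <= 2 * D).
  { intros i Hi. unfold y. pose proof (He i Hi) as Hei.
    assert (HeW : vnorm (e i) <= W) by lra.
    pose proof (Hup (e i) vzero HeW H0W) as H.
    replace (x [+] vzero) with x in H by vec.
    replace (e i [-] vzero) with (e i) in H by vec.
    assert (D * vnorm (e i) <= D * 1) by (apply Rmult_le_compat_l; lra). lra. }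
  (* Coordinates are at most [2 * L] in absolute value, and rounding moves them by at most 1; hence
     the requirement [2 * L + 1 <= INR P]. *)
  set (z := fun i => Int_part (c i)).
  assert (Hz : forall i, Rabs (c i - IZR (z i)) <= 1).
  { intros i. destruct (base_Int_part (c i)). unfold z. apply Rabs_le. lra. }
  assert (HzP : forall i, (i < n)%nat -> Rabs (IZR (z i)) <= INR P).
  { intros i Hi. pose proof (Hc c i Hi) as H1. rewrite HL in H1.
    pose proof (Rabs_triang (c i) (- (c i - IZR (z i)))) as H2.
    rewrite Rabs_Ropp in H2. pose proof (Hz i).
    replace (c i + - (c i - IZR (z i))) with (IZR (z i)) in H2 by ring. lra. }
  assert (Hin := lattice_box_in e P n z HzP).
  assert (Hwalk := walk_lattice X Y G x C W e n (INR P) z n He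
    (fun i b Hi Hb => Hd2 (e i) b (Hunit i Hi) Hb) HzP HC HPW (Nat.le_refl n)).
  fold y in Hwalk.
  pose proof (lincomb_norm_le (fun i => c i - IZR (z i)) e n 1 1 ltac:(lra)
    (fun i _ => Hz i) He) as Hre.
  pose proof (lincomb_norm_le (fun i => c i - IZR (z i)) y n 1 (2 * D) ltac:(lra)
    (fun i _ => Hz i) Hy) as Hry.
  rewrite lincomb_sub in Hre. rewrite lincomb_sub in Hry.
  set (a := lincomb (fun i => IZR (z i)) e n) in *.
  set (ay := lincomb (fun i => IZR (z i)) y n) in *.
  set (u := lincomb c e n) in *. set (uy := lincomb c y n) in *.
  pose proof (Hlow a Hin) as Ha.
  pose proof (lattice_box_norm e P n a He Hin) as HaP.
  assert (HaW : vnorm a <= W) by lra.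
  pose proof (Hup a vzero HaW H0W) as Hau.
  replace (x [+] vzero) with x in Hau by vec.
  replace (a [-] vzero) with a in Hau by vec.
  assert (Hau1 : vnorm a <= L + INR n).
  { pose proof (vnorm_sub u (u [-] a)) as H.
    replace (u [-] (u [-] a)) with a in H by vec. lra. }
  assert (Hau2 : L - INR n <= vnorm a).
  { pose proof (vnorm_triangle X (u [-] a) a) as H.
    replace (u [-] a [+] a) with u in H by vec. lra. }
  assert (HDa : D * vnorm a <= D * (L + INR n)) by (apply Rmult_le_compat_l; lra).
  set (g := G (x [+] a) [-] G x) in *.
  pose proof (vnorm_triangle Y (g [-] (g [-] ay)) (uy [-] ay)) as T1.
  replace (g [-] (g [-] ay) [+] (uy [-] ay)) with uy in T1 by vec.
  pose proof (vnorm_sub g (g [-] ay)) as T2.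
  pose proof (vnorm_triangle Y (uy [-] (uy [-] ay)) (g [-] ay)) as T3.
  replace (uy [-] (uy [-] ay) [+] (g [-] ay)) with g in T3 by vec.
  pose proof (vnorm_sub uy (uy [-] ay)) as T4.
  split; lra.
Qed.

(** Rescale to norm [L]. For a combination of norm 0 the bounded coordinate functionals force all
    coefficients to vanish. *)
Lemma homogeneous_bounds {X Y : NormedSpace} (e : nat -> X) (y : nat -> Y) n L p q :
  near_auerbach e n -> 0 < L ->
  (forall c, vnorm (lincomb c e n) = L -> p * L <= vnorm (lincomb c y n) <= q * L) ->
  forall c, p * vnorm (lincomb c e n) <= vnorm (lincomb c y n) <= q * vnorm (lincomb c e n).
Proof.
  intros [_ Hc] HL H c.
  destruct (Req_dec (vnorm (lincomb c e n)) 0) as [H0|H0].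
  - rewrite H0. rewrite (lincomb_ext c (fun _ => 0) y y).
    + rewrite lincomb_0, vnorm_0. lra.
    + intros i Hi. pose proof (Hc c i Hi) as H1. rewrite H0 in H1.
      destruct (Req_dec (c i) 0) as [E|E]; [exact E|].
      apply Rabs_pos_lt in E. lra.
    + reflexivity.
  - pose proof (vnorm_ge0 (lincomb c e n)) as Hpos.
    set (t := vnorm (lincomb c e n)) in *.
    assert (Ht : 0 < t) by lra.
    assert (HLt : 0 < L / t) by (apply Rdiv_lt_0_compat; lra).
    pose proof (H (fun i => L / t * c i)) as H1.
    rewrite !lincomb_scal, !vnorm_scal_pos in H1 by lra. fold t in H1.
    assert (Hs : L / t * t = L) by (field; lra).
    specialize (H1 Hs). set (v := vnorm (lincomb c y n)) in *.
    split; apply Rmult_le_reg_l with (L / t); try exact HLt.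
    + replace (L / t * (p * t)) with (p * L) by (field; lra). lra.
    + replace (L / t * (q * t)) with (q * L) by (field; lra). lra.
Qed.

(** The map sends [x] to the combination of the [y i] with some chosen coordinates of [x].
    Differences of chosen coordinates are coordinates of the difference, so the two-sided bound
    applies, with scale [p]. *)
Lemma embeds_with_of_coefs {X Y : NormedSpace} (e : nat -> X) (y : nat -> Y) n p q M :
  spans e n -> 0 < p ->
  (forall c, p * vnorm (lincomb c e n) <= vnorm (lincomb c y n) <= q * vnorm (lincomb c e n)) ->
  embeds_with X Y M (q / p).
Proof.
  intros Hs Hp H. destruct (choice (fun x c => x = lincomb c e n) Hs) as [crd Hcrd].
  exists (fun x => lincomb (crd x) y n), p. split; [exact Hp|].
  intros x x' _ _. unfold vdist.
  replace (x [-] x') with (lincomb (fun i => crd x i - crd x' i) e n)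
    by (rewrite lincomb_sub, <- !Hcrd; reflexivity).
  rewrite <- lincomb_sub. replace (q / p * p) with q by (field; lra). apply H.
Qed.

(** * Bases with bounded coordinate functionals *)

(** Written with Stdlib operations, so that the facts on determinants can be used outside the
    MathComp section. *)
Fixpoint fsum (f : nat -> R) (n : nat) : R :=
  match n with
  | O => 0
  | S k => fsum f k + f k
  end.

(** * Determinants and Cramer's rule *)

Section Determinant.

Import all_boot all_order all_fingroup all_algebra Rstruct.
Import Order.TTheory GRing.Theory Num.Theory.
Local Open Scope ring_scope.

Let mx (n : nat) (w : nat -> nat -> R) : 'M[R]_n := \matrix_(i, j) w i j.

Lemma fsum_big f n : fsum f n = \sum_(i < n) f i.
Proof.
elim: n => [|n IH]; first by rewrite big_ord0.
by rewrite big_ord_recr /= IH.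
Qed.

(** A crude bound from the Leibniz formula, which makes the supremum of the determinants finite. *)
Lemma det_bounded n b w :
  (forall i j, (i < n)%coq_nat -> (j < n)%coq_nat -> Rle (Rabs (w i j)) b) ->
  Rabs (\det (mx n w)) <= \sum_(s : 'S_n) \prod_(i < n) b.
Proof.
move=> H; rewrite RabsE.
apply: le_trans (ler_norm_sum _ _ _) _.
apply: ler_sum => s _.
rewrite normrM normrX normrN1 expr1n mul1r normr_prod.
apply: ler_prod => i _; rewrite normr_ge0 /= mxE -RabsE.
by apply/RleP; apply: H; apply/ssrnat.ltP.
Qed.

Lemma cramer_row n (w : nat -> nat -> R) (c : nat -> R) i : (i < n)%N ->
  \det (mx n (fun k => if k == i then (fun j => fsum (fun l => c l * w l j) n) else w k)) =
  c i * \det (mx n w).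
Proof.
move=> Hi; pose i0 := Ordinal Hi.
set w' := fun k => _.
pose u : 'rV[R]_n := \row_j c j.
have Ev j : mx n w' i0 j = (u *m mx n w) 0 j.
  by rewrite !mxE /w' eqxx fsum_big; apply: eq_bigr => l _; rewrite !mxE.
rewrite (expand_det_row _ i0).
(* The cofactors along row [i] do not see that row, so they are those of the original matrix, and
   the expansion is an entry of a product with its adjugate. *)
have -> : \sum_j mx n w' i0 j * cofactor (mx n w') i0 j =
          (u *m mx n w *m \adj (mx n w)) 0 i0.
  rewrite [RHS]mxE; apply: eq_bigr => j _; rewrite Ev; congr (_ * _).
  rewrite [RHS]mxE /cofactor; congr (_ * \det _).
  apply/matrixP => k l; rewrite !mxE /w'.
  suff -> : (nat_of_ord (lift i0 k) == i) = false by [].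
  by apply/negbTE; apply/eqP => E; move: (neq_lift i0 k) => /eqP; apply; apply: val_inj.
by rewrite -mulmxA mul_mx_adj mul_mx_scalar !mxE mulrC; exact: erefl.
Qed.

Lemma det_rows_span n (w : nat -> nat -> R) (c : nat -> R) : \det (mx n w) != 0 ->
  exists a : nat -> R, forall j, (j < n)%coq_nat -> c j = fsum (fun l => a l * w l j) n.
Proof.
move=> Hd.
rewrite -unitfE -unitmxE in Hd.
have [u Eu] : exists u : 'rV[R]_n, u *m mx n w = \row_j c j.
  by exists ((\row_j c j) *m invmx (mx n w)); rewrite mulmxKV.
(* [insub] reads an index below [n] as an ordinal; beyond [n] the value is 0 by default. *)
exists (fun l => if insub l is Some l' then u 0 l' else 0) => j /ssrnat.ltP Hj.
have := congr1 (fun M : 'rV[R]_n => M 0 (Ordinal Hj)) Eu; rewrite !mxE /= => <-.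
by rewrite fsum_big; apply: eq_bigr => l _; rewrite !mxE valK.
Qed.

(* Rows whose determinant is at least half of the supremum: by Cramer's rule the
   coefficients of a vector of [P] are quotients of two determinants with rows in [P]. *)
Lemma near_maximal_rows n (P : (nat -> R) -> Prop) (b r : R) : Rlt 0 r ->
  (forall c, P c -> forall i, (i < n)%coq_nat -> Rle (Rabs (c i)) b) ->
  (forall i, (i < n)%coq_nat -> P (fun j => if Nat.eqb i j then r else IZR 0)) ->
  exists w : nat -> nat -> R, [/\ forall i, (i < n)%coq_nat -> P (w i),
    forall c, P (fun j => fsum (fun l => Rmult (c l) (w l j)) n) ->
      forall i, (i < n)%coq_nat -> Rle (Rabs (c i)) 2 &
    forall c, exists a, forall j, (j < n)%coq_nat -> c j = fsum (fun l => Rmult (a l) (w l j)) n].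
Proof.
move=> Hr Hb HP.
pose E x := exists2 w : nat -> nat -> R, (forall i, (i < n)%coq_nat -> P (w i)) &
  x = Rabs (\det (mx n w)).
have Ebound : bound E.
  exists (\sum_(s : 'S_n) \prod_(i < n) b : R)%R => x [w Hw ->]; apply/RleP; apply: det_bounded => i j Hi Hj.
  exact: Hb (Hw i Hi) j Hj.
(* The scalar matrix [r] has admissible rows and a nonzero determinant, so the supremum is
   positive. *)
have Er : E (Rabs (r ^+ n)).
  exists (fun i j => if Nat.eqb i j then r else IZR 0); first exact: HP.
  rewrite -det_scalar; congr (Rabs (\det _)); apply/matrixP => i j; rewrite !mxE.
  case: (Nat.eqb_spec i j) => [/val_inj ->|Hij]; first by rewrite eqxx.
  by case: eqVneq => // E'; case: Hij; rewrite E'.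
have [m [Hm1 Hm2]] := completeness E Ebound (ex_intro _ _ Er).
have Hm0 : Rlt 0 m.
  apply: Rlt_le_trans (Hm1 _ Er); apply: Rabs_pos_lt; apply/eqP; rewrite expf_neq0 //.
  by apply/eqP; apply: Rgt_not_eq.
have [w Hw Hdet] : exists2 w, (forall i, (i < n)%coq_nat -> P (w i)) &
    Rlt (Rdiv m 2) (Rabs (\det (mx n w))).
  apply: NNPP => Hno; suff: Rle m (Rdiv m 2) by lra.
  apply: Hm2 => x [w Hw ->]; apply: Rnot_lt_le => Hlt.
  by apply: Hno; exists w.
exists w; split => //.
- move=> c Hc i Hi; have /ssrnat.ltP Hi' := Hi.
  (* By Cramer's rule this is the determinant with row [i] replaced by another admissible row, hence
     at most the supremum. *)
  have H : Rle (Rabs (Rmult (c i) (\det (mx n w)))) m.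
    apply: Hm1; rewrite RmultE -cramer_row //.
    eexists; last by [].
    by move=> k Hk /=; case: (k == i); [exact: Hc | exact: Hw].
  rewrite Rabs_mult in H.
  apply: Rnot_lt_le => Hlt.
  have : Rlt (Rmult 2 (Rdiv m 2)) (Rmult (Rabs (c i)) (Rabs (\det (mx n w)))).
    by apply: Rmult_le_0_lt_compat => //; lra.
  by lra.
- move=> c; apply: det_rows_span; apply/eqP => E0; move: Hdet; rewrite E0 Rabs_R0; lra.
Qed.

End Determinant.

(** * Boundedness of coordinates and existence of near-Auerbach bases *)

Lemma lincomb_fsum {X : NormedSpace} (c : nat -> R) (w : nat -> nat -> R) (e : nat -> X) n m :
  lincomb (fun j => fsum (fun i => c i * w i j) m) e n =
  lincomb c (fun i => lincomb (w i) e n) m.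
Proof.
  induction m as [|m IH]; cbn [fsum lincomb]; [apply lincomb_0|].
  rewrite <- IH, <- lincomb_scal, <- lincomb_add. reflexivity.
Qed.

Lemma family_bounded {X : NormedSpace} (e : nat -> X) n :
  exists E, 0 <= E /\ forall i, (i < n)%nat -> vnorm (e i) <= E.
Proof.
  induction n as [|n [E [HE H]]]; [exists 0; split; [lra|lia]|].
  exists (E + vnorm (e n)). pose proof (vnorm_ge0 (e n)). split; [lra|].
  intros i Hi. destruct (Nat.eq_dec i n) as [->|]; [lra|].
  assert (vnorm (e i) <= E) by (apply H; lia). lra.
Qed.

Lemma lin_indep_pred {X : NormedSpace} (e : nat -> X) n : lin_indep e (S n) -> lin_indep e n.
Proof.
  intros H c Hc i Hi.
  assert (H0 := H (fun j => if Nat.eqb j n then 0 else c j)).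
  cbn [lincomb] in H0. rewrite Nat.eqb_refl, (lincomb_ext _ c e e) in H0.
  - rewrite Hc in H0. assert (Hz : vzero [+] 0 [*] e n = vzero) by vec.
    specialize (H0 Hz i ltac:(lia)). destruct (Nat.eqb_spec i n); [lia|exact H0].
  - intros j Hj. destruct (Nat.eqb_spec j n); [lia|reflexivity].
  - reflexivity.
Qed.

(** Continuity of the coordinate functionals with some constant, which later bounds the matrix
    entries in the determinant argument. *)
Definition coefs_dominated {X : NormedSpace} (b : R) (e : nat -> X) (n : nat) : Prop :=
  forall c i, (i < n)%nat -> Rabs (c i) <= b * vnorm (lincomb c e n).

Lemma le_of_le_inv_nat (x C : R) : (forall k, x <= C * / INR (S k)) -> x <= 0.
Proof.
  intros H. apply Rnot_lt_le. intros Hx.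
  destruct (archimed_cor1 (x / (Rabs C + 1))) as [k [Hk1 Hk2]].
  { apply Rdiv_lt_0_compat; [exact Hx|]. pose proof (Rabs_pos C). lra. }
  pose proof (H k) as Hk. pose proof (Rabs_pos C) as HC. pose proof (Rle_abs C).
  assert (H1 : / INR (S k) <= / INR k).
  { apply Rinv_le_contravar; [apply lt_0_INR; lia|apply le_INR; lia]. }
  assert (Hk0 : 0 < / INR (S k)) by (apply Rinv_0_lt_compat, lt_0_INR; lia).
  assert (H2 : C * / INR (S k) <= (Rabs C + 1) * / INR (S k))
    by (apply Rmult_le_compat_r; lra).
  assert (H3 : (Rabs C + 1) * / INR (S k) < (Rabs C + 1) * (x / (Rabs C + 1)))
    by (apply Rmult_lt_compat_l; lra).
  replace ((Rabs C + 1) * (x / (Rabs C + 1))) with x in H3 by (field; lra). lra.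
Qed.

(* A combination of [e 0, ..., e (n-1)] cannot approximate [- e n], since the
   coefficients of approximants would converge. *)
Lemma distance_to_span {X : NormedSpace} (e : nat -> X) n b :
  0 <= b -> coefs_dominated b e n -> lin_indep e (S n) ->
  exists d, 0 < d /\ forall c, d <= vnorm (lincomb c e n [+] e n).
Proof.
  intros Hb0 Hb Hli. apply NNPP. intros Hno.
  assert (Hseq : forall k : nat, exists c, vnorm (lincomb c e n [+] e n) <= / INR (S k)).
  { intros k. apply NNPP. intros Hk. apply Hno. exists (/ INR (S k)).
    split; [apply Rinv_0_lt_compat, lt_0_INR; lia|].
    intros c. apply Rnot_lt_le. intros Hc. apply Hk. exists c. lra. }
  destruct (choice _ Hseq) as [cs Hcs].
  assert (Hcauchy : forall k l i, (i < n)%nat ->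
    Rabs (cs k i - cs l i) <= b * (/ INR (S k) + / INR (S l))).
  { intros k l i Hi. pose proof (Hb (fun j => cs k j - cs l j) i Hi) as H1. cbv beta in H1.
    rewrite lincomb_sub in H1.
    pose proof (vnorm_sub (lincomb (cs k) e n [+] e n) (lincomb (cs l) e n [+] e n)) as H2.
    replace (lincomb (cs k) e n [+] e n [-] (lincomb (cs l) e n [+] e n)) with
      (lincomb (cs k) e n [-] lincomb (cs l) e n) in H2 by vec.
    pose proof (Hcs k). pose proof (Hcs l).
    eapply Rle_trans; [exact H1|]. apply Rmult_le_compat_l; lra. }
  (* The limit comes with an explicit rate, so the error of the limiting combination is bounded by a
     multiple of [/ INR (S k)] for every [k]. *)
  assert (Hlim : forall i, exists l, (i < n)%nat ->
    forall k, Rabs (cs k i - l) <= 2 * b * / INR (S k)).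
  { intros i. destruct (Nat.lt_ge_cases i n) as [Hi|Hi]; [|exists 0; lia].
    assert (HC : Cauchy_crit (fun k => cs k i)).
    { intros eps Heps.
      destruct (archimed_cor1 (eps / (2 * b + 1))) as [N [HN1 HN2]].
      { apply Rdiv_lt_0_compat; lra. }
      exists N. intros k l Hk Hl. unfold Rdist.
      assert (Hinv : forall j, (j >= N)%nat -> / INR (S j) <= / INR N).
      { intros j Hj. apply Rinv_le_contravar; [apply lt_0_INR; lia|apply le_INR; lia]. }
      pose proof (Hinv k Hk). pose proof (Hinv l Hl).
      assert (HN0 : 0 < / INR N) by (apply Rinv_0_lt_compat, lt_0_INR; lia).
      assert (b * (/ INR (S k) + / INR (S l)) <= b * (2 * / INR N))
        by (apply Rmult_le_compat_l; lra).
      assert (H3 : (2 * b + 1) * / INR N < (2 * b + 1) * (eps / (2 * b + 1)))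
        by (apply Rmult_lt_compat_l; lra).
      replace ((2 * b + 1) * (eps / (2 * b + 1))) with eps in H3 by (field; lra).
      pose proof (Hcauchy k l i Hi). lra. }
    destruct (R_complete _ HC) as [l Hl]. exists l. intros _ k.
    apply Rnot_lt_le. intros Hlt.
    destruct (Hl (Rabs (cs k i - l) - 2 * b * / INR (S k))) as [N HN]; [lra|].
    set (p := max N k). assert (Hp := HN p ltac:(unfold p; lia)). unfold Rdist in Hp.
    pose proof (Hcauchy k p i Hi) as H1.
    assert (H2 : / INR (S p) <= / INR (S k)).
    { apply Rinv_le_contravar; [apply lt_0_INR; lia|apply le_INR; unfold p; lia]. }
    assert (H3 : b * (/ INR (S k) + / INR (S p)) <= b * (2 * / INR (S k)))
      by (apply Rmult_le_compat_l; lra).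
    pose proof (Rabs_triang (cs k i - cs p i) (cs p i - l)) as H4.
    replace (cs k i - cs p i + (cs p i - l)) with (cs k i - l) in H4 by ring. lra. }
  destruct (choice _ Hlim) as [c Hc].
  destruct (family_bounded e n) as [E [HE0 HE]].
  assert (H0 : vnorm (lincomb c e n [+] e n) <= 0).
  { apply le_of_le_inv_nat with (INR n * (2 * b * E) + 1). intros k.
    assert (Hk0 : 0 < / INR (S k)) by (apply Rinv_0_lt_compat, lt_0_INR; lia).
    assert (H1 : vnorm (lincomb (fun i => cs k i - c i) e n) <=
      INR n * (2 * b * / INR (S k) * E)).
    { apply lincomb_norm_le; [|intros; apply Hc; assumption|exact HE].
      apply Rmult_le_pos; lra. }
    rewrite lincomb_sub in H1.
    pose proof (vnorm_sub (lincomb (cs k) e n [+] e n)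
      (lincomb (cs k) e n [-] lincomb c e n)) as H2.
    replace (lincomb (cs k) e n [+] e n [-] (lincomb (cs k) e n [-] lincomb c e n))
      with (lincomb c e n [+] e n) in H2 by vec.
    pose proof (Hcs k). lra. }
  assert (Hz : lincomb c e n [+] e n = vzero).
  { apply vnorm_eq0. pose proof (vnorm_ge0 (lincomb c e n [+] e n)). lra. }
  assert (H1 := Hli (fun j => if Nat.eqb n j then 1 else c j)).
  cbn [lincomb] in H1. rewrite Nat.eqb_refl, (lincomb_ext _ c e e), vscal_1 in H1.
  - specialize (H1 Hz n ltac:(lia)). cbv beta in H1. rewrite Nat.eqb_refl in H1. lra.
  - intros j Hj. destruct (Nat.eqb_spec n j); [lia|reflexivity].
  - reflexivity.
Qed.

(** Induction on [n]: the last coefficient is controlled by the distance [d] from the last vector to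
    the span of the others, and the rest by the induction hypothesis after subtracting the last
    term. *)
Lemma lin_indep_coefs_dominated {X : NormedSpace} (e : nat -> X) n :
  lin_indep e n -> exists b, 0 <= b /\ coefs_dominated b e n.
Proof.
  induction n as [|n IH]; intros Hli; [exists 0; split; [lra|intros c i Hi; lia]|].
  destruct (IH (lin_indep_pred e n Hli)) as [b [Hb0 Hb]].
  destruct (distance_to_span e n b Hb0 Hb Hli) as [d [Hd0 Hd]].
  pose proof (vnorm_ge0 (e n)) as Hen.
  assert (Hid : 0 < / d) by (apply Rinv_0_lt_compat; exact Hd0).
  assert (Hq : 0 <= b * (1 + / d * vnorm (e n))).
  { apply Rmult_le_pos; [exact Hb0|].
    assert (0 <= / d * vnorm (e n)) by (apply Rmult_le_pos; lra). lra. }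
  exists (/ d + b * (1 + / d * vnorm (e n))). split; [lra|].
  assert (Hlast : forall c, Rabs (c n) <= / d * vnorm (lincomb c e (S n))).
  { intros c. destruct (Req_dec (c n) 0) as [E|E].
    - rewrite E, Rabs_R0. apply Rmult_le_pos; [lra|apply vnorm_ge0].
    - replace (lincomb c e (S n)) with (c n [*] (lincomb (fun i => / c n * c i) e n [+] e n)).
      + rewrite vnorm_scal. pose proof (Hd (fun i => / c n * c i)) as H.
        pose proof (Rabs_pos (c n)).
        apply Rmult_le_reg_l with d; [exact Hd0|].
        rewrite <- Rmult_assoc, Rinv_r, Rmult_1_l, Rmult_comm by lra.
        apply Rmult_le_compat_l; lra.
      + rewrite lincomb_scal. cbn [lincomb].
        rewrite vscal_distr_v, vscal_assoc, Rinv_r, vscal_1 by exact E. reflexivity. }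
  intros c i Hi. pose proof (Hlast c) as Hcn.
  set (t := vnorm (lincomb c e (S n))) in *.
  assert (Ht : 0 <= t) by apply vnorm_ge0.
  assert (H1 : 0 <= / d * t) by (apply Rmult_le_pos; lra).
  assert (H2 : 0 <= b * (1 + / d * vnorm (e n)) * t) by (apply Rmult_le_pos; lra).
  destruct (Nat.eq_dec i n) as [->|Hin]; [lra|].
  pose proof (Hb c i ltac:(lia)) as Hci.
  pose proof (vnorm_sub (lincomb c e (S n)) (c n [*] e n)) as H3. fold t in H3.
  cbn [lincomb] in H3.
  replace (lincomb c e n [+] c n [*] e n [-] c n [*] e n) with (lincomb c e n) in H3 by vec.
  rewrite vnorm_scal in H3.
  assert (H4 : Rabs (c n) * vnorm (e n) <= / d * t * vnorm (e n))
    by (apply Rmult_le_compat_r; lra).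
  assert (H5 : b * vnorm (lincomb c e n) <= b * ((1 + / d * vnorm (e n)) * t)).
  { apply Rmult_le_compat_l; [exact Hb0|]. lra. }
  lra.
Qed.

Lemma near_auerbach_exists {X : NormedSpace} (e : nat -> X) n : lin_indep e n ->
  exists e' : nat -> X, near_auerbach e' n /\ (spans e n -> spans e' n).
Proof.
  intros Hli. destruct (lin_indep_coefs_dominated e n Hli) as [b [Hb0 Hb]].
  destruct (family_bounded e n) as [E [HE0 HE]].
  set (r := / (E + 1)).
  assert (Hr : 0 < r) by (apply Rinv_0_lt_compat; lra).
  destruct (near_maximal_rows n (fun c => vnorm (lincomb c e n) <= 1) b r Hr)
    as [w [Hw1 Hw2 Hw3]].
  - intros c Hc i Hi. pose proof (Hb c i Hi).
    assert (b * vnorm (lincomb c e n) <= b * 1) by (apply Rmult_le_compat_l; lra). lra.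
  - intros i Hi.
    rewrite (lincomb_ext _ (fun j => r * (if Nat.eqb i j then 1 else 0)) e e).
    + rewrite lincomb_scal, lincomb_unit, vnorm_scal_pos by (auto; lra).
      pose proof (HE i Hi).
      assert (r * vnorm (e i) <= r * (E + 1)) by (apply Rmult_le_compat_l; lra).
      unfold r in *. rewrite Rinv_l in * by lra. lra.
    + intros j _. destruct (Nat.eqb i j); ring.
    + reflexivity.
  - exists (fun i => lincomb (w i) e n). split; [split|].
    + exact Hw1.
    + intros c i Hi. set (t := vnorm _).
      assert (Ht : 0 <= t) by apply vnorm_ge0.
      apply Rnot_lt_le. intros Hlt.
      assert (Hci : 0 < Rabs (c i)) by lra.
      (* Dividing by some [u] strictly above [t] brings the combination into the unit ball even when
         [t] is 0. Since [u] is below half of [Rabs (c i)], the rescaled coefficient exceeds 2. *)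
      assert (Hgap : exists u, t < u /\ 2 * u < Rabs (c i)).
      { exists ((t + Rabs (c i) / 2) / 2). lra. }
      destruct Hgap as [u [Hu1 Hu2]].
      pose proof (Hw2 (fun j => / u * c j)) as H. cbv beta in H.
      rewrite lincomb_fsum, lincomb_scal, vnorm_scal_pos in H
        by (left; apply Rinv_0_lt_compat; lra).
      assert (Hiu : 0 < / u) by (apply Rinv_0_lt_compat; lra).
      fold t in H.
      assert (H1 : / u * t <= 1).
      { rewrite <- (Rinv_l u) by lra. apply Rmult_le_compat_l; lra. }
      specialize (H H1 i Hi). rewrite Rabs_mult, (Rabs_right (/ u)) in H by lra.
      assert (H2 : u * (/ u * Rabs (c i)) <= u * 2) by (apply Rmult_le_compat_l; lra).
      rewrite <- Rmult_assoc, Rinv_r in H2 by lra. lra.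
    + intros Hs x. destruct (Hs x) as [c Hc]. destruct (Hw3 c) as [a Ha].
      exists a. rewrite <- lincomb_fsum, Hc. apply lincomb_ext; auto.
Qed.

(** * A priori embeddings of the whole space *)

Lemma near_auerbach_norm_le {X : NormedSpace} (e : nat -> X) n (Y : NormedSpace) (y : nat -> Y) c :
  near_auerbach e n -> near_auerbach y n ->
  vnorm (lincomb c y n) <= 2 * INR n * vnorm (lincomb c e n).
Proof.
  intros [_ He] [Hy _].
  replace (2 * INR n * vnorm (lincomb c e n)) with (INR n * (2 * vnorm (lincomb c e n) * 1)) by ring.
  apply lincomb_norm_le; [|intros; apply He; assumption|exact Hy].
  pose proof (vnorm_ge0 (lincomb c e n)). lra.
Qed.

(** Matching near-Auerbach bases of [X] and of an n-dimensional subspace of [Y] changes norms by a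
    factor of at most [2 * INR n] in either direction. *)
Lemma embeds_with_dim_square (X Y : NormedSpace) n M :
  (1 <= n)%nat -> has_dim X n -> infinite_dim Y -> embeds_with X Y M (4 * (INR n * INR n)).
Proof.
  intros Hn [e [He1 He2]] HY. destruct (HY n) as [y Hy].
  destruct (near_auerbach_exists e n He1) as [e' [He Hs]].
  destruct (near_auerbach_exists y n Hy) as [y' [Hy' _]].
  apply (le_INR 1) in Hn. simpl in Hn.
  replace (4 * (INR n * INR n)) with (2 * INR n / / (2 * INR n)) by (field; lra).
  apply (embeds_with_of_coefs e' y' n); [auto|apply Rinv_0_lt_compat; lra|].
  intros c. split; [|apply near_auerbach_norm_le; assumption].
  apply Rmult_le_reg_l with (2 * INR n); [lra|].
  rewrite <- Rmult_assoc, Rinv_r, Rmult_1_l by lra.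
  apply near_auerbach_norm_le; assumption.
Qed.

Lemma embeds_with_dim_le1 (X Y : NormedSpace) n M :
  (n <= 1)%nat -> has_dim X n -> infinite_dim Y -> embeds_with X Y M 1.
Proof.
  intros Hn [e [He1 He2]] HY. destruct (HY 1%nat) as [y Hy].
  assert (Hnz : forall (Z : NormedSpace) (z : nat -> Z), lin_indep z 1 -> 0 < vnorm (z O)).
  { intros Z z Hz. destruct (vnorm_ge0 (z O)) as [H|H]; [exact H|].
    symmetry in H. apply vnorm_eq0 in H.
    assert (E : lincomb (fun _ => 1) z 1 = vzero) by (simpl; rewrite H; vec).
    pose proof (Hz _ E O Nat.lt_0_1). lra. }
  pose proof (Hnz Y y Hy) as Hy0.
  replace 1 with (1 / 1) by field.
  apply (embeds_with_of_coefs e (fun i => (vnorm (e i) / vnorm (y O)) [*] y O) n);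
    [exact He2|lra|].
  intros c. rewrite !Rmult_1_l.
  enough (E : vnorm (lincomb c (fun i => (vnorm (e i) / vnorm (y O)) [*] y O) n) =
    vnorm (lincomb c e n)) by lra.
  destruct n as [|[|n]]; [|clear He1|lia].
  - simpl. rewrite !vnorm_0. reflexivity.
  - simpl.
    replace (vzero [+] c O [*] ((vnorm (e O) / vnorm (y O)) [*] y O)) with
      ((c O * (vnorm (e O) / vnorm (y O))) [*] y O) by vec.
    replace (vzero [+] c O [*] e O) with (c O [*] e O) by vec.
    pose proof (vnorm_ge0 (e O)).
    rewrite !vnorm_scal, Rabs_mult, (Rabs_right (vnorm (e O) / vnorm (y O))).
    + field. lra.
    + apply Rle_ge, Rmult_le_pos; [lra|]. left. apply Rinv_0_lt_compat. exact Hy0.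
Qed.

(** * Distortion of nets *)

Lemma distortion_spec X Y M : is_distortion X Y M (distortion X Y M).
Proof.
  unfold distortion. apply epsilon_spec.
  destruct (classic (exists D, 1 <= D /\ embeds_with X Y M D)) as [HD|HD].
  (* [completeness] yields suprema, so the infimum is minus the supremum of the negatives. *)
  - set (E := fun x => exists D, 1 <= D /\ embeds_with X Y M D /\ x = - D).
    destruct (completeness E) as [m [Hm1 Hm2]].
    + exists (-1). intros x (D & HD1 & _ & ->). lra.
    + destruct HD as (D & HD1 & HD2). exists (- D), D. auto.
    + exists (Fin (- m)). split; [|split; [|exact HD]].
      * intros D HD1 HD2. assert (- D <= m) by (apply Hm1; exists D; auto). lra.
      * intros r Hr. assert (m <= - r); [|lra].
        apply Hm2. intros x (D & HD1 & HD2 & ->). pose proof (Hr D HD1 HD2). lra.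
  - exists PInf. intros D HD1 HD2. apply HD. exists D. auto.
Qed.

(** As [X] embeds with constant [D0], an embedding of the net with constant at least [D0] is
    harmless; only smaller constants have to be carried over to all of [X]. *)
Lemma disc_good_intro X Y eps delta D0 :
  0 < eps < 1 -> 1 <= D0 -> embeds_with X Y (fun _ => True) D0 ->
  (forall N D, delta_net X delta N -> 1 <= D < D0 -> embeds_with X Y N D ->
    exists D', 1 <= D' /\ embeds_with X Y (fun _ => True) D' /\ (1 - eps) * D' <= D) ->
  disc_good X Y eps delta.
Proof.
  intros Heps HD0 HX HN N Hnet.
  pose proof (distortion_spec X Y (fun _ => True)) as HcX.
  pose proof (distortion_spec X Y N) as HcN.
  destruct (distortion X Y (fun _ => True)) as [c|]; [|exfalso; exact (HcX D0 HD0 HX)].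
  destruct (distortion X Y N) as [d|]; simpl; [|exact I].
  destruct HcX as (Hc1 & Hc2 & _). destruct HcN as (_ & Hd2 & _).
  apply Hd2. intros D HD HDN.
  assert (H1c : 1 <= c) by (apply Hc2; auto).
  destruct (Rlt_le_dec D D0) as [Hlt|Hge].
  - destruct (HN N D Hnet (conj HD Hlt) HDN) as (D' & HD'1 & HD'2 & HD'3).
    pose proof (Hc1 D' HD'1 HD'2).
    assert ((1 - eps) * c <= (1 - eps) * D') by (apply Rmult_le_compat_l; lra). lra.
  - pose proof (Hc1 D0 HD0 HX).
    assert ((1 - eps) * c <= 1 * c) by (apply Rmult_le_compat_r; lra). lra.
Qed.

(** Scale a point into the unit ball, pass to a nearby net point, embed and scale back. Each of two
    points moves by at most [Rad * delta] in the original scale, and the embedding multiplies this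
    by at most [D]. *)
Lemma coarse_map_of_net X Y delta N D Rad :
  delta_net X delta N -> embeds_with X Y N D -> 1 <= D -> 0 < Rad -> 0 <= delta ->
  exists F : X -> Y, forall x y, vnorm x <= Rad -> vnorm y <= Rad ->
    vnorm (x [-] y) - 2 * (D * Rad * delta) <= vnorm (F x [-] F y) <=
      D * vnorm (x [-] y) + 2 * (D * Rad * delta).
Proof.
  intros [_ Hnet] (g & s & Hs & Hg) HD HR Hdelta.
  assert (Hpr : forall x : X, exists p, vnorm x <= 1 -> N p /\ vdist x p <= delta).
  { intros x. destruct (Rle_dec (vnorm x) 1) as [Hx|Hx].
    - destruct (Hnet x Hx) as [p Hp]. exists p. auto.
    - exists vzero. intros H. contradiction. }
  destruct (choice _ Hpr) as [p Hp].
  assert (HiR : 0 < / Rad) by (apply Rinv_0_lt_compat; exact HR).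
  exists (fun x => (Rad / s) [*] g (p (/ Rad [*] x))). intros x y Hx Hy.
  assert (Hball : forall z : X, vnorm z <= Rad -> vnorm (/ Rad [*] z) <= 1).
  { intros z Hz. rewrite vnorm_scal_pos by lra.
    rewrite <- (Rinv_l Rad) by lra. apply Rmult_le_compat_l; lra. }
  destruct (Hp _ (Hball x Hx)) as [HNx Hdx]. destruct (Hp _ (Hball y Hy)) as [HNy Hdy].
  set (x' := / Rad [*] x) in *. set (y' := / Rad [*] y) in *.
  destruct (Hg (p x') (p y') HNx HNy) as [Hlow Hup].
  unfold vdist in *.
  replace ((Rad / s) [*] g (p x') [-] (Rad / s) [*] g (p y')) with
    ((Rad / s) [*] (g (p x') [-] g (p y'))) by vec.
  assert (HRs : 0 < Rad / s) by (apply Rdiv_lt_0_compat; lra).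
  rewrite vnorm_scal_pos by lra.
  assert (Exy : vnorm (x [-] y) = Rad * vnorm (x' [-] y')).
  { rewrite <- vnorm_scal_pos by lra. f_equal. unfold x', y'. vec_coefs; field; lra. }
  pose proof (vnorm_triangle X (x' [-] p x' [-] (y' [-] p y')) (p x' [-] p y')) as T1.
  replace (x' [-] p x' [-] (y' [-] p y') [+] (p x' [-] p y')) with (x' [-] y') in T1 by vec.
  pose proof (vnorm_sub (x' [-] p x') (y' [-] p y')) as T2.
  pose proof (vnorm_sub (x' [-] y') (x' [-] p x' [-] (y' [-] p y'))) as T3.
  replace (x' [-] y' [-] (x' [-] p x' [-] (y' [-] p y'))) with (p x' [-] p y') in T3 by vec.
  set (u := vnorm (p x' [-] p y')) in *. set (v := vnorm (g (p x') [-] g (p y'))) in *.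
  assert (Hd0 : 0 <= Rad * delta) by (apply Rmult_le_pos; lra).
  assert (HDd : 1 * (Rad * delta) <= D * (Rad * delta)) by (apply Rmult_le_compat_r; lra).
  assert (L1 : Rad / s * (s * u) <= Rad / s * v) by (apply Rmult_le_compat_l; lra).
  assert (L2 : Rad / s * v <= Rad / s * (D * s * u)) by (apply Rmult_le_compat_l; lra).
  replace (Rad / s * (s * u)) with (Rad * u) in L1 by (field; lra).
  replace (Rad / s * (D * s * u)) with (D * (Rad * u)) in L2 by (field; lra).
  assert (U1 : Rad * u <= Rad * (vnorm (x' [-] y') + 2 * delta))
    by (apply Rmult_le_compat_l; lra).
  assert (U2 : Rad * (vnorm (x' [-] y') - 2 * delta) <= Rad * u)
    by (apply Rmult_le_compat_l; lra).
  assert (U3 : D * (Rad * u) <= D * (Rad * (vnorm (x' [-] y') + 2 * delta)))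
    by (apply Rmult_le_compat_l; lra).
  rewrite Exy. split; lra.
Qed.

(** [L] dominates the error [6 * (INR n * D)], [P] covers the coordinates of vectors of norm [L],
    [W] covers the lattice walks, [M] makes second differences small, [K] exceeds the initial
    variation and so bounds the number of passes, and [Rad] makes room for all progressions. *)
Lemma linear_embedding_of_net (X Y : NormedSpace) n (e : nat -> X) delta N D (P M K : nat) L W Rad :
  near_auerbach e n -> spans e n -> (1 <= n)%nat ->
  delta_net X delta N -> embeds_with X Y N D -> 1 <= D -> 0 <= delta ->
  6 * (INR n * D) < L -> 2 * L + 1 <= INR P -> 3 * (INR n * INR P) <= W -> 1 <= W ->
  9 * (D * W) <= INR M -> 3 * (D * W) * (INR n * INR P) <= INR M ->
  INR ((2 * P + 1) ^ n) * (D * W + 1) < INR K ->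
  W * INR (M ^ ((2 * P + 1) ^ n * K) * M) + 2 * W <= Rad ->
  4 * (D * Rad * delta) <= 1 ->
  embeds_with X Y (fun _ => True)
    (D * (1 + 6 * (INR n * D) / L) / (1 - 6 * (INR n * D) / L)).
Proof.
  intros He Hs Hn Hnet HN HD Hdelta HL HP HPW HW HM HMC HK HR Hdl.
  set (A := lattice_box e P n).
  assert (HAl : length A = ((2 * P + 1) ^ n)%nat) by apply lattice_box_length.
  rewrite <- HAl in HK, HR.
  assert (HR0 : 0 < Rad).
  { assert (0 <= W * INR (M ^ (length A * K) * M)) by (apply Rmult_le_pos; [lra|apply pos_INR]).
    lra. }
  destruct (coarse_map_of_net X Y delta N D Rad Hnet HN HD HR0 Hdelta) as [F HF].
  set (dl := 2 * (D * Rad * delta)) in *.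
  assert (Hdl' : 0 <= dl <= 1 / 2).
  { unfold dl. split; [|lra].
    apply Rmult_le_pos; [lra|]. apply Rmult_le_pos; [|exact Hdelta]. apply Rmult_le_pos; lra. }
  apply (le_INR 1) in Hn as Hn'. simpl in Hn'.
  assert (HnD : 1 * 1 <= INR n * D) by (apply Rmult_le_compat; lra).
  assert (HnP : 1 * INR P <= INR n * INR P) by (apply Rmult_le_compat_r; lra).
  assert (HDW : 1 * 1 <= D * W) by (apply Rmult_le_compat; lra).
  assert (HA : forall a, In a A -> vnorm a <= W).
  { intros a Ha. pose proof (lattice_box_norm e P n a (proj1 He) Ha). lra. }
  assert (HMpos : (0 < M)%nat) by (apply INR_lt; simpl; lra).
  assert (HWM : 0 <= W * INR M) by (apply Rmult_le_pos; [lra|apply pos_INR]).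
  assert (Hvar : variation_bound X Y W Rad A M F (INR (length A) * (D * W + 1))).
  { intros x Hx. apply variation_le. intros b Hb. pose proof (HA b Hb) as HbW.
    pose proof (vnorm_triangle X x b).
    assert (H1 : vnorm (F (x [+] b) [-] F x) <= D * vnorm (x [+] b [-] x) + dl)
      by (apply HF; lra).
    replace (x [+] b [-] x) with b in H1 by vec.
    assert (D * vnorm b <= D * W) by (apply Rmult_le_compat_l; lra). lra. }
  assert (HC : 3 * (D * W) <= INR M * / (INR n * INR P)).
  { apply Rmult_le_reg_r with (INR n * INR P); [lra|].
    replace (INR M * / (INR n * INR P) * (INR n * INR P)) with (INR M)
      by (rewrite Rmult_assoc, Rinv_l; lra).
    exact HMC. }
  (* The first averaging length is [M], which is also [m0]. Second differences of at most
     [/ (INR n * INR P)] keep the total error of a lattice walk below 1. *)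
  destruct (nearly_affine_point X Y F A D dl W Rad M HA HW HD Hdl' HM HF
    M (/ (INR n * INR P)) K M F _ (conj HMpos (Nat.le_refl M)) HC
    (tame_refl X Y F D dl W Rad HW HF M) Hvar HK HR) as (G & x & HG1 & HG2 & HG3).
  assert (HC0 : 0 <= / (INR n * INR P)) by (left; apply Rinv_0_lt_compat; lra).
  assert (HC1 : INR n * INR P * / (INR n * INR P) <= 1) by (rewrite Rinv_r; lra).
  pose proof (derivative_bounds e n G x D dl W _ P L He Hn HD Hdl' HC0 HC1 HP HPW
    HG1 HG2 HG3) as Hder.
  assert (Hk6 : 0 < 6 * (INR n * D)) by lra.
  set (k := 6 * (INR n * D)) in *.
  assert (Hk : 0 < 1 - k / L).
  { replace (1 - k / L) with ((L - k) / L) by (field; lra). apply Rdiv_lt_0_compat; lra. }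
  apply (embeds_with_of_coefs e (fun i => G (x [+] e i) [-] G x) n); [exact Hs|exact Hk|].
  apply (homogeneous_bounds e _ n L); [exact He|lra|].
  intros c Hc. pose proof (Hder c Hc) as H.
  replace ((1 - k / L) * L) with (L - k) by (field; lra).
  replace (D * (1 + k / L) * L) with (D * (L + k)) by (field; lra). exact H.
Qed.

(** * Numerical choice of the parameters *)

Lemma const_mul_pow_le q a j k : 2 <= q -> 0 <= a <= 2 ^ k -> a * q ^ j <= q ^ (k + j).
Proof.
  intros Hq Ha. rewrite pow_add. apply Rmult_le_compat_r; [apply pow_le; lra|].
  assert (2 ^ k <= q ^ k) by (apply pow_incr; lra). lra.
Qed.

(** Every parameter is bounded by a power of [q], numerical constants being absorbed because [q] is
    at least 2. *)
Lemma net_rigidity X Y n eps (Q : nat) delta N D :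
  (1 <= n <= Q)%nat -> (2 <= Q)%nat -> 0 < eps < 1 -> INR n / eps <= INR Q ->
  has_dim X n -> delta_net X delta N -> 1 <= D <= 4 * INR Q ^ 2 -> embeds_with X Y N D ->
  0 <= delta -> delta * exp (INR Q ^ (22 * n + 25)) <= 1 ->
  exists D', 1 <= D' /\ embeds_with X Y (fun _ => True) D' /\ (1 - eps) * D' <= D.
Proof.
  intros Hn HQ Heps HnQ HX Hnet HD HN Hd0 Hd1.
  destruct HX as [e0 [Hli Hsp]]. destruct (near_auerbach_exists e0 n Hli) as [e [He Hs]].
  specialize (Hs Hsp).
  set (q := INR Q) in *.
  assert (Hq : 2 <= q) by (apply (le_INR 2); exact HQ).
  assert (Hn1 : 1 <= INR n) by (apply (le_INR 1); lia).
  assert (Hnq : INR n <= q) by (apply le_INR; lia).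
  (* From [INR n <= q * eps] and [D <= 4 * q ^ 2] one gets [12 * (INR n * D) <= eps * L]. Then [P]
     is [2 * L + 1], and [W] exceeds [3 * (INR n * INR P)], which is at most [291 * q ^ 4]. The
     powers 30 and 17 are generous: [M] must exceed a multiple of [q ^ 10], and [K] divided by [a] a
     multiple of [q ^ 6]. *)
  set (P := (96 * Q ^ 3 + 1)%nat).
  set (M := (Q ^ 30)%nat).
  set (a := ((2 * P + 1) ^ n)%nat).
  set (K := (a * Q ^ 17)%nat).
  set (L := 48 * q ^ 3). set (W := 300 * q ^ 4).
  set (Rad := W * INR (M ^ (a * K) * M) + 2 * W).
  assert (HPq : INR P = 96 * q ^ 3 + 1).
  { unfold P. rewrite plus_INR, mult_INR, pow_INR. fold q. simpl (INR 1). f_equal. f_equal.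
    rewrite INR_IZR_INZ. reflexivity. }
  assert (HMq : INR M = q ^ 30) by (unfold M; rewrite pow_INR; reflexivity).
  assert (Hq1 : forall k, 1 <= q ^ k) by (intros k; apply pow_R1_Rle; lra).
  assert (Hprod : forall x y c1 c2 i j, 0 <= x <= c1 * q ^ i -> 0 <= y <= c2 * q ^ j ->
    0 <= x * y <= c1 * c2 * q ^ (i + j)).
  { intros x y c1 c2 i j Hx Hy. split; [apply Rmult_le_pos; lra|].
    rewrite pow_add. replace (c1 * c2 * (q ^ i * q ^ j)) with (c1 * q ^ i * (c2 * q ^ j)) by ring.
    apply Rmult_le_compat; lra. }
  assert (HD' : 0 <= D <= 4 * q ^ 2) by lra.
  assert (HW' : 0 <= W <= 300 * q ^ 4) by (unfold W; pose proof (Hq1 4%nat); lra).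
  assert (Hn' : 0 <= INR n <= 1 * q ^ 1) by lra.
  assert (HP' : 0 <= INR P <= 97 * q ^ 3) by (rewrite HPq; pose proof (Hq1 3%nat); lra).
  pose proof (Hprod _ _ _ _ _ _ Hn' HD') as HnD.
  pose proof (Hprod _ _ _ _ _ _ HD' HW') as HDW.
  pose proof (Hprod _ _ _ _ _ _ Hn' HP') as HnP.
  pose proof (Hprod _ _ _ _ _ _ HDW HnP) as HDWnP.
  cbn [Nat.add] in HnD, HDW, HnP, HDWnP.
  assert (Ha1 : 1 <= INR a).
  { apply (le_INR 1). unfold a. pose proof (Nat.pow_nonzero (2 * P + 1) n). lia. }
  assert (Haq : INR a <= q ^ (11 * n)).
  { unfold a. rewrite pow_INR, pow_mult. apply pow_incr. split; [apply pos_INR|].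
    rewrite plus_INR, mult_INR. simpl (INR 1). change (INR 2) with 2. rewrite HPq.
    pose proof (const_mul_pow_le q 195 3 8 Hq ltac:(simpl; lra)) as H. cbn [Nat.add] in H.
    pose proof (Hq1 3%nat). lra. }
  assert (HKq : INR K = INR a * q ^ 17).
  { unfold K. rewrite mult_INR, pow_INR. reflexivity. }
  assert (HaK : INR (a * K) <= q ^ (22 * n + 17)).
  { rewrite mult_INR, HKq.
    replace (22 * n + 17)%nat with (11 * n + (11 * n + 17))%nat by lia. rewrite !pow_add.
    pose proof (Hq1 17%nat).
    assert (0 <= INR a * q ^ 17) by (apply Rmult_le_pos; lra).
    apply Rmult_le_compat; [lra|lra|lra|]. apply Rmult_le_compat_r; lra. }
  (* The radius grows like [M ^ (a * K)], where [a * K] is itself at most a power of [q] with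
     exponent linear in [n]; this is the source of the double exponential. *)
  assert (HRad : 4 * (D * Rad) <= q ^ (50 + 30 * (a * K))).
  { assert (HR1 : INR (M ^ (a * K) * M) = q ^ (30 * (a * K) + 30)).
    { rewrite mult_INR, pow_INR, HMq, pow_add, (pow_mult q 30). reflexivity. }
    assert (HR2 : 0 <= Rad <= 900 * q ^ (34 + 30 * (a * K))).
    { unfold Rad. rewrite HR1.
      replace (34 + 30 * (a * K))%nat with (4 + (30 * (a * K) + 30))%nat by lia.
      rewrite (pow_add q 4). fold W. replace (900 * (q ^ 4 * q ^ (30 * (a * K) + 30))) with
        (3 * (W * q ^ (30 * (a * K) + 30))) by (unfold W; ring).
      pose proof (Hq1 (30 * (a * K) + 30)%nat).
      assert (W * 1 <= W * q ^ (30 * (a * K) + 30)) by (apply Rmult_le_compat_l; lra).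
      lra. }
    pose proof (Hprod _ _ _ _ _ _ HD' HR2) as [_ HDR].
    pose proof (const_mul_pow_le q 14400 (36 + 30 * (a * K)) 14 Hq ltac:(simpl; lra)) as H.
    replace (14 + (36 + 30 * (a * K)))%nat with (50 + 30 * (a * K))%nat in H by lia.
    change (2 + (34 + 30 * (a * K)))%nat with (36 + 30 * (a * K))%nat in HDR.
    lra. }
  (* Compare logarithms; the bound [ln q <= q] costs one more power of [q]. *)
  assert (Hexp : q ^ (50 + 30 * (a * K)) <= exp (q ^ (22 * n + 25))).
  { rewrite <- Rpower_pow by lra. unfold Rpower.
    assert (Hle : INR (50 + 30 * (a * K)) * ln q <= q ^ (22 * n + 25)).
    { assert (Hln0 : 0 <= ln q) by (left; rewrite <- ln_1; apply ln_increasing; lra).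
      assert (Hln : ln q <= q).
      { pose proof (exp_ineq1_le (ln q)) as H. rewrite exp_ln in H by lra. lra. }
      assert (H1 : INR (50 + 30 * (a * K)) <= q ^ (22 * n + 24)).
      { rewrite plus_INR, (mult_INR 30).
        replace (INR 50) with 50 by (rewrite INR_IZR_INZ; reflexivity).
        replace (INR 30) with 30 by (rewrite INR_IZR_INZ; reflexivity).
        pose proof (const_mul_pow_le q 80 (22 * n + 17) 7 Hq ltac:(simpl; lra)) as H.
        replace (7 + (22 * n + 17))%nat with (22 * n + 24)%nat in H by lia.
        pose proof (Hq1 (22 * n + 17)%nat). lra. }
      replace (22 * n + 25)%nat with (22 * n + 24 + 1)%nat by lia.
      rewrite pow_add, pow_1. apply Rmult_le_compat; auto using pos_INR. }
    destruct Hle as [Hle|Hle]; [left; apply exp_increasing; exact Hle|right; f_equal; exact Hle]. }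
  pose proof (Hq1 2%nat) as Hq2. pose proof (Hq1 3%nat) as Hq3. pose proof (Hq1 4%nat) as Hq4.
  assert (HLn : 12 * (INR n * D) <= eps * L).
  { assert (H1 : INR n <= q * eps).
    { apply Rmult_le_reg_r with (/ eps); [apply Rinv_0_lt_compat; lra|].
      rewrite Rmult_assoc, Rinv_r by lra. unfold Rdiv in HnQ. lra. }
    assert (H2 : INR n * D <= q * eps * (4 * q ^ 2)) by (apply Rmult_le_compat; lra).
    unfold L. replace (q ^ 3) with (q * q ^ 2) by (simpl; ring). lra. }
  assert (HL0 : 0 < L) by (unfold L; lra).
  assert (HepsL : eps * L < 1 * L) by (apply Rmult_lt_compat_r; lra).
  exists (D * (1 + 6 * (INR n * D) / L) / (1 - 6 * (INR n * D) / L)).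
  set (k := 6 * (INR n * D) / L).
  assert (Hk : 0 <= k <= eps / 2).
  { unfold k. split.
    - apply Rmult_le_pos; [lra|]. left. apply Rinv_0_lt_compat. exact HL0.
    - apply Rmult_le_reg_r with L; [exact HL0|].
      replace (6 * (INR n * D) / L * L) with (6 * (INR n * D)) by (field; lra). lra. }
  split; [|split].
  - apply Rmult_le_reg_r with (1 - k); [lra|].
    replace (D * (1 + k) / (1 - k) * (1 - k)) with (D * (1 + k)) by (field; lra).
    assert (1 * 1 <= D * (1 + k)) by (apply Rmult_le_compat; lra). lra.
  - apply (linear_embedding_of_net X Y n e delta N D P M K L W Rad); auto; try lra.
    + lia.
    + rewrite HPq. unfold L. lra.
    + unfold W. lra.
    + unfold W. lra.
    + pose proof (const_mul_pow_le q 10800 6 24 Hq ltac:(simpl; lra)) as H.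
      cbn [Nat.add] in H. lra.
    + pose proof (const_mul_pow_le q 349200 10 20 Hq ltac:(simpl; lra)) as H.
      cbn [Nat.add] in H. lra.
    + fold a. rewrite HKq. apply Rmult_lt_compat_l; [lra|].
      pose proof (const_mul_pow_le q 1202 6 11 Hq ltac:(simpl; lra)) as H.
      cbn [Nat.add] in H. pose proof (Hq1 6%nat). lra.
    + fold a. unfold Rad. lra.
    + assert (delta * (4 * (D * Rad)) <= delta * exp (q ^ (22 * n + 25)))
        by (apply Rmult_le_compat_l; lra).
      lra.
  (* The claim reduces to [(1 - eps) * (1 + k) <= 1 - k], which follows from [2 * k <= eps]. *)
  - apply Rmult_le_reg_r with (1 - k); [lra|].
    replace ((1 - eps) * (D * (1 + k) / (1 - k)) * (1 - k)) with (D * ((1 - eps) * (1 + k)))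
      by (field; lra).
    apply Rmult_le_compat_l; [lra|].
    assert (0 <= eps * k) by (apply Rmult_le_pos; lra). lra.
Qed.

Lemma disc_good_explicit X Y n eps :
  has_dim X n -> infinite_dim Y -> 0 < eps < 1 ->
  disc_good X Y eps (exp (- Rpower (INR n / eps) (100 * INR n))).
Proof.
  intros HX HY Heps.
  destruct (Nat.le_gt_cases n 1) as [Hn|Hn].
  (* In dimension at most 1 the space embeds isometrically, and no [D] satisfies [1 <= D < 1]. All
     other dimensions give [t] at least 2. *)
  { apply disc_good_intro with 1; [exact Heps|lra| |].
    - exact (embeds_with_dim_le1 X Y n _ Hn HX HY).
    - intros N D _ HD. lra. }
  assert (Hn2 : 2 <= INR n) by (apply (le_INR 2); exact Hn).
  set (t := INR n / eps).
  assert (Hnt : INR n <= t).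
  { unfold t. apply Rmult_le_reg_r with eps; [lra|].
    replace (INR n / eps * eps) with (INR n) by (field; lra).
    assert (INR n * eps <= INR n * 1) by (apply Rmult_le_compat_l; lra). lra. }
  destruct (archimed t) as [HQ1 HQ2].
  set (Q := Z.to_nat (up t)).
  assert (Hup : (0 < up t)%Z) by (apply lt_IZR; lra).
  assert (HQ : INR Q = IZR (up t)) by (unfold Q; rewrite INR_IZR_INZ; f_equal; lia).
  assert (HnQ : (n <= Q)%nat) by (apply INR_le; lra).
  (* Rounding up gives [INR Q <= t + 1], and [t] is at least 2. *)
  assert (HQt : INR Q <= t ^ 2) by (simpl; nra).
  assert (Hdim : 1 <= 4 * (INR n * INR n)) by nra.
  apply disc_good_intro with (4 * (INR n * INR n)); [exact Heps|exact Hdim| |].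
  - apply (embeds_with_dim_square X Y n); auto. lia.
  - intros N D Hnet HD HN.
    apply (net_rigidity X Y n eps Q (exp (- Rpower t (100 * INR n))) N D); auto.
    + lia.
    + lia.
    + fold t. lra.
    + apply le_INR in HnQ. simpl. nra.
    + left. apply exp_pos.
    + rewrite <- exp_plus, <- exp_0.
      (* Replacing [INR Q] by [t ^ 2] gives the exponent [44 * n + 50], which is at most [100 * n];
         hence the constant 100. *)
      assert (Hle : INR Q ^ (22 * n + 25) <= Rpower t (100 * INR n)).
      { replace (100 * INR n) with (INR (100 * n))
          by (rewrite mult_INR, (INR_IZR_INZ 100); reflexivity).
        rewrite Rpower_pow by lra.
        apply Rle_trans with ((t ^ 2) ^ (22 * n + 25)).
        - apply pow_incr. split; [apply pos_INR|exact HQt].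
        - rewrite <- pow_mult. apply Rle_pow; [lra|lia]. }
      destruct Hle as [Hle|Hle]; [left; apply exp_increasing; lra|right; f_equal; lra].
Qed.

Theorem theorem1p1 :
  exists C : R, 0 < C /\
    forall (X Y : NormedSpace) (n : nat),
      Banach X -> Banach Y -> has_dim X n -> infinite_dim Y ->
      forall eps : R, 0 < eps < 1 ->
        exists m : R, is_disc_modulus X Y eps m /\
          exp (- Rpower (INR n / eps) (C * INR n)) <= m.
Proof.
  exists 100. split; [lra|]. intros X Y n _ _ HX HY eps Heps.
  set (delta := exp (- Rpower (INR n / eps) (100 * INR n))).
  assert (Hdelta : 0 < delta < 1 /\ disc_good X Y eps delta).
  { split; [split; [apply exp_pos|]|apply disc_good_explicit; assumption].
    rewrite <- exp_0. apply exp_increasing.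
    assert (0 < Rpower (INR n / eps) (100 * INR n)) by apply exp_pos. lra. }
  destruct (completeness (fun d => 0 < d < 1 /\ disc_good X Y eps d)) as [m Hm].
  - exists 1. intros d [Hd _]. lra.
  - exists delta. exact Hdelta.
  - exists m. split; [exact Hm|]. apply Hm. exact Hdelta.
Qed.
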